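(* Let $0<\alpha<2$, and let $\phi_n$ be the random map defined in the context, with capacities $c_n^*=\frac{c}{1+\alpha c(n-1)}$ and $\theta_n$ i.i.d. uniform on $[0,2\pi]$. Then for any $r>1$ there are constants $\lambda^1(\alpha,c,r),\lambda^2(\alpha,c,r)>0$ such that for every $n\ge1$ $$\mathbb{P}\left(\sup_{|z|\geq r}\left|e^{-\sum_{i=1}^n c_i^*}\phi_n(z)-z\right|>\frac{\log n}{\sqrt{n}}\right)<\lambda^1(\alpha,c,r)\,e^{-\frac{(\log n)^2}{\lambda^2(\alpha,c,r)}} .$$ Hence $$\mathbb{P}\left(\limsup_{n\to\infty}\left\{\sup_{|z|\geq r}\left|e^{-\sum_{i=1}^n c_i^*}\phi_n(z)-z\right|>\frac{\log n}{\sqrt{n}}\right\}\right)=0,$$ where $\limsup_{n}$ denotes the limsup of events (infinitely many of the events occur).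
   Context: $\Delta=\{z\in\mathbb{C}:|z|>1\}$. Fix $c>0$ and a constant $\tilde\lambda\in[0,\infty)$. For each $c'\in(0,c]$, $f_{c'}:\Delta\to\Delta$ is a conformal (injective holomorphic) map onto $\Delta$ minus a particle of logarithmic capacity $c'$ attached at $z=1$, of the form $$f_{c'}(z)=e^{c'}z\exp\left(\frac{2c'}{z-1}+\delta_{c'}(z)\right),\qquad |\delta_{c'}(z)|<\frac{\tilde\lambda\,(c')^{3/2}|z|}{|z-1|(|z|-1)}\quad(z\in\Delta).$$ Let $\theta_1,\theta_2,\dots$ be i.i.d. uniform on $[0,2\pi]$, $c_n^*=\frac{c}{1+\alpha c(n-1)}$, $f_n(z)=e^{i\theta_n}f_{c_n^*}(ze^{-i\theta_n})$, and $\phi_n=f_1\circ\cdots\circ f_n$ on $\Delta$. Constants may also depend on the fixed $\tilde\lambda$. *)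

(* Defs.v *)
From HB Require Import structures.
From mathcomp Require Import all_boot all_order all_algebra.
From mathcomp Require Import all_classical all_reals all_analysis.
From mathcomp Require Import complex.

Set Implicit Arguments.
Unset Strict Implicit.
Unset Printing Implicit Defensive.

Import Order.TTheory GRing.Theory Num.Theory.
Import numFieldNormedType.Exports.

Local Open Scope classical_set_scope.
Local Open Scope ring_scope.
Local Open Scope complex_scope.

(** * Complex analysis *)

(* The norm `|z| of the library on R[i] takes its (real) values in R[i];
   cabs is the same quantity as an element of R. *)
Definition cabs (R : realType) (z : R[i]) : R := complex.Re `|z|.

Definition cexp (R : realType) (z : R[i]) : R[i] :=
  (expR (complex.Re z))%:C * (cos (complex.Im z) +i* sin (complex.Im z)).

Definition exterior_disc (R : realType) : set R[i] := [set z | 1 < cabs z].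

Definition closed_disc (R : realType) : set R[i] := [set z | cabs z <= 1].

Definition holomorphic_on (R : realType) (D : set R[i]) (g : R[i] -> R[i]) :=
  forall z, D z -> derivable (g : R[i]^o -> R[i]^o) z 1.

Definition conformal_onto (R : realType) (D E : set R[i]) (g : R[i] -> R[i]) :=
  [/\ holomorphic_on D g, {in D &, injective g} & g @` D = E].

(* K has logarithmic capacity a when the complement of K is the image of the
   exterior disc under a conformal map g with g(z) / z --> e^a as z --> oo;
   the limit is taken in the variable w = 1 / z. *)
Definition has_log_capacity (R : realType) (K : set R[i]) (a : R) :=
  exists2 g : R[i] -> R[i],
    conformal_onto (@exterior_disc R) (~` K) g &
    (fun w : R[i]^o => w * g w^-1 : R[i]^o) @ 0^' --> ((expR a)%:C : R[i]^o).

(* P is a particle attached to the closed unit disc at the point 1.  The usual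
   requirement that the union of P and the disc has no holes is implied by the
   existence of the conformal map in has_log_capacity. *)
Definition particle (R : realType) (P : set R[i]) :=
  [/\ P `<=` @exterior_disc R,
      connected (P : set R[i]^o),
      compact (@closed_disc R `|` P : set R[i]^o) &
      closure (P : set R[i]^o) 1].

(* f a maps the exterior disc D conformally onto D minus a particle of
   logarithmic capacity a attached at 1, for every a in ]0, c]. *)
Definition particle_maps (R : realType) (c : R) (f : R -> R[i] -> R[i]) :=
  forall a, 0 < a <= c -> exists P : set R[i],
    [/\ particle P,
        has_log_capacity (@closed_disc R `|` P) a &
        conformal_onto (@exterior_disc R) (@exterior_disc R `\` P) (f a)].

Definition particle_estimate (R : realType) (c lambda : R)
    (f delta : R -> R[i] -> R[i]) :=
  forall a z, 0 < a <= c -> exterior_disc z ->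
    f a z = (expR a)%:C * z * cexp ((2 * a)%:C / (z - 1) + delta a z) /\
    cabs (delta a z)
      < lambda * a `^ (3 / 2) * cabs z / (cabs (z - 1) * (cabs z - 1)).

(** * The growth process *)

(* Indices start at 0: with c*_n = c / (1 + alpha c (n - 1)) for n >= 1,
   capacity alpha c n is c*_(n+1), and theta n is the angle of the map with
   capacity c*_(n+1). *)
Definition capacity (R : realType) (alpha c : R) (n : nat) : R :=
  c / (1 + alpha * c * n%:R).

Definition rotated (R : realType) (g : R[i] -> R[i]) (t : R) (z : R[i]) : R[i] :=
  cexp (t%:C * 'i) * g (z * cexp (- t%:C * 'i)).

Fixpoint cluster_map (R : realType) (alpha c : R) (f : R -> R[i] -> R[i])
    (theta : nat -> R) (n : nat) : R[i] -> R[i] :=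
  if n is m.+1 then
    cluster_map alpha c f theta m \o rotated (f (capacity alpha c m)) (theta m)
  else id.

Definition deviation (R : realType) (alpha c r : R) (f : R -> R[i] -> R[i])
    (theta : nat -> R) (n : nat) : \bar R :=
  ereal_sup [set (cabs ((expR (- \sum_(i < n) capacity alpha c i))%:C *
                        cluster_map alpha c f theta n z - z))%:E
            | z in [set z | r <= cabs z]].

(** * Random angles *)

Definition mutually_independent d (T : measurableType d) (R : realType)
    (P : probability T R) (X : nat -> {RV P >-> R}) :=
  forall (s : seq nat) (A : nat -> set R), uniq s ->
    (forall i, measurable (A i)) ->
    P (\bigcap_(i in [set` s]) (X i @^-1` A i)) =
    (\prod_(i <- s) P (X i @^-1` A i))%E.

Definition uniform_angle d (T : measurableType d) (R : realType)
    (P : probability T R) (X : {RV P >-> R}) :=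
  forall A : set R, measurable A ->
    distribution P X A = uniform_prob (mulr_gt0 (ltr0Sn R 1) (pi_gt0 R)) A.

Definition large_deviation d (T : measurableType d) (R : realType)
    (P : probability T R) (alpha c r : R) (f : R -> R[i] -> R[i])
    (theta : nat -> {RV P >-> R}) (n : nat) : set T :=
  [set w | ((ln n%:R / Num.sqrt n%:R)%:E
              < deviation alpha c r f (fun i => theta i w) n)%E].

(* Main.v *)
Require Import Defs.
From mathcomp Require Import all_boot all_order all_algebra.
From mathcomp Require Import all_classical all_reals all_analysis.
From mathcomp Require Import complex measurable_realfun.
From mathcomp Require Import ring lra.

Set Implicit Arguments.
Unset Strict Implicit.
Unset Printing Implicit Defensive.

Import Order.TTheory GRing.Theory Num.Theory.
Import numFieldNormedType.Exports.

Local Open Scope classical_set_scope.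
Local Open Scope ring_scope.

(** Why the theorem holds.  Count the particles from 0, let a_k be the capacity
of the k-th map F_k and S_k the sum of a_i over k <= i < n.  Reading
F_0 o ... o F_(n-1) from the inside, a point z has the orbit Z_n = z,
Z_k = F_k(Z_(k+1)), and Z_0 is its image under the cluster map; the quantity of
interest is M_0 - z, where M_k = e^(-S_k) Z_k.

One step is described by the particle estimate ([rotated_step]): with
w = Z_(k+1) and angle t = theta_k,
  M_k = M_(k+1) + e^(-S_(k+1)) 2 a_k w / (w e^(-it) - 1)
        + O(e^(-S_(k+1)) a_k^(3/2))
as long as |w| stays away from 1.  Since e^(-S_k) is at most of order
(k/n)^(1/alpha) and a_k is of order 1/k, the assumption alpha < 2 makes the
error terms add up to O(n^(-1/2)), and the squares of e^(-S_(k+1)) a_k to O(1/n)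
([sum_capacity32_tail_le], [sum_sqr_capacity_tail_le]); both are telescoping
comparisons.

In the main term the random point w may be replaced by its deterministic
approximation e^(S_(k+1)) z.  The cost is of order
a_k e^(-S_(k+1)) |M_(k+1) - z|, and the weights a_k e^(-S_(k+1)) have a bounded
sum, so a discrete Gronwall argument, run for k decreasing from n, bounds
|M_0 - z| by a constant times n^(-1/2) plus the largest partial sum of the
linearized terms.  The same induction keeps the orbit away from the unit circle
([normalized_deviation_le]).

The linearized terms are independent.  Expanding them in a geometric series in
1/z turns their sum into a power series whose coefficients are the trigonometric
sums of 2 a_i e^(-m S_(i+1)) e^(i m theta_i), which do not depend on z.  Hence
the supremum over |z| >= r is controlled by n coefficients and a geometrically
small remainder ([sum_fluctuation_le]).  Each coefficient is a sum of independent
centred variables with variance O(1/n) and obeys a Hoeffding bound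
([hoeffding_tail]).  A union bound over the coefficients and the partial sums
costs a factor of order n^2 = e^(2 log n), which e^(-(log n)^2 / C) absorbs; the
finitely many small n are absorbed by the constant.

The deviation events are measurable because the maps are continuous, so that the
supremum may be taken over a countable set ([measurable_large_deviation]).  The
tails are summable, and the second claim is the Borel-Cantelli lemma. *)

(** * Modulus and exponential of complex numbers *)

Section ComplexModulus.
Local Open Scope complex_scope.
Context {R : realType}.
Implicit Types (z w : R[i]) (x t : R).

Lemma cabsE z : `|z| = (cabs z)%:C.
Proof. by rewrite /cabs normc_def. Qed.

Lemma cabs_sqrt z : cabs z = Num.sqrt (complex.Re z ^+ 2 + complex.Im z ^+ 2).
Proof. by rewrite /cabs normc_def. Qed.

Lemma cabs_ge0 z : 0 <= cabs z.
Proof. by rewrite cabs_sqrt sqrtr_ge0. Qed.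

Lemma cabs_sqr z : cabs z ^+ 2 = complex.Re z ^+ 2 + complex.Im z ^+ 2.
Proof. by rewrite cabs_sqrt sqr_sqrtr// addr_ge0// sqr_ge0. Qed.

Lemma cabsM z w : cabs (z * w) = cabs z * cabs w.
Proof. by apply: complexI; rewrite rmorphM/= -!cabsE normrM. Qed.

Lemma cabsV z : cabs z^-1 = (cabs z)^-1.
Proof. by apply: complexI; rewrite fmorphV/= -!cabsE normfV. Qed.

Lemma cabsX z n : cabs (z ^+ n) = cabs z ^+ n.
Proof. by apply: complexI; rewrite rmorphXn/= -!cabsE normrX. Qed.

Lemma cabsN z : cabs (- z) = cabs z.
Proof. by apply: complexI; rewrite -!cabsE normrN. Qed.

Lemma cabsC z w : cabs (z - w) = cabs (w - z).
Proof. by rewrite -cabsN opprB. Qed.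

Lemma cabsD z w : cabs (z + w) <= cabs z + cabs w.
Proof. by rewrite -lecR rmorphD/= -!cabsE ler_normD. Qed.

Lemma cabsB_ge z w : cabs z - cabs w <= cabs (z - w).
Proof. by rewrite lerBlDr (le_trans _ (cabsD _ _))// subrK. Qed.

Lemma cabs_real x : cabs x%:C = `|x|.
Proof. by rewrite cabs_sqrt/= expr0n/= addr0 sqrtr_sqr. Qed.

Lemma cabs0 : cabs (0 : R[i]) = 0.
Proof. by rewrite (cabs_real 0) normr0. Qed.

Lemma cabs1 : cabs (1 : R[i]) = 1.
Proof. by rewrite (cabs_real 1) normr1. Qed.

Lemma cabs_eq0 z : (cabs z == 0) = (z == 0).
Proof. by rewrite -[RHS]normr_eq0 cabsE (inj_eq (@complexI _)). Qed.

Lemma cabs_gt0 z : (0 < cabs z) = (z != 0).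
Proof. by rewrite lt_def cabs_ge0 andbT cabs_eq0. Qed.

Lemma cabs_sum (I : Type) (s : seq I) (P : pred I) (F : I -> R[i]) :
  cabs (\sum_(i <- s | P i) F i) <= \sum_(i <- s | P i) cabs (F i).
Proof.
elim/big_rec2: _ => [|i y z _ h]; first by rewrite cabs0.
by rewrite (le_trans (cabsD _ _))// lerD2l.
Qed.

Lemma Re_le_cabs z : `|complex.Re z| <= cabs z.
Proof.
rewrite cabs_sqrt -sqrtr_sqr ler_wsqrtr// lerDl sqr_ge0//.
Qed.

Lemma Im_le_cabs z : `|complex.Im z| <= cabs z.
Proof.
rewrite cabs_sqrt -sqrtr_sqr ler_wsqrtr// lerDr sqr_ge0//.
Qed.

Lemma cabs_le_ReIm z : cabs z <= `|complex.Re z| + `|complex.Im z|.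
Proof.
rewrite -ler_sqr ?nnegrE ?addr_ge0 ?cabs_ge0// cabs_sqr sqrrD.
rewrite !real_normK ?num_real// lerD2r lerDl mulrn_wge0// mulr_ge0//.
Qed.

Lemma cabs_cis t : cabs (cos t +i* sin t) = 1.
Proof. by rewrite cabs_sqrt/= cos2Dsin2 sqrtr1. Qed.

Lemma cexpE z : cexp z = (expR (complex.Re z) * cos (complex.Im z)) +i*
  (expR (complex.Re z) * sin (complex.Im z)).
Proof. by rewrite /cexp; simpc. Qed.

Lemma cexpD z w : cexp (z + w) = cexp z * cexp w.
Proof.
rewrite !cexpE; case: z => a b; case: w => a' b'; simpc => /=.
rewrite expRD cosD sinD; congr (_ +i* _); ring.
Qed.

Lemma cexp0 : cexp 0 = 1 :> R[i].
Proof. by rewrite cexpE /= expR0 cos0 sin0 mulr0 mulr1. Qed.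

Lemma cexp_rotE t : cexp (t%:C * 'i) = cos t +i* sin t.
Proof. by rewrite cexpE/=; simpc; rewrite expR0 !mul1r. Qed.

Lemma cabs_rot t : cabs (cexp (t%:C * 'i)) = 1.
Proof. by rewrite cexp_rotE cabs_cis. Qed.

Lemma cexp_rotN t : cexp (- t%:C * 'i) = (cexp (t%:C * 'i))^-1.
Proof.
have h : cexp (- t%:C * 'i) * cexp (t%:C * 'i) = 1.
  by rewrite -cexpD -mulrDl addNr mul0r cexp0.
have h0 : cexp (t%:C * 'i) != 0 by rewrite -cabs_gt0 cabs_rot.
by apply: (mulIf h0); rewrite h mulVf.
Qed.

Lemma cabs_rotN t : cabs (cexp (- t%:C * 'i)) = 1.
Proof. by rewrite cexp_rotN cabsV cabs_rot invr1. Qed.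

Lemma cexp_rotX t m :
  cexp (t%:C * 'i) ^+ m = cos (m%:R * t) +i* sin (m%:R * t).
Proof.
rewrite -cexp_rotE; elim: m => [|m IH].
  by rewrite expr0 !mul0r cexp0.
rewrite exprS IH -cexpD -mulrDl -rmorphD/=; do 2 congr (_ _).
by rewrite -natr1 mulrDl mul1r addrC.
Qed.

Lemma sin_le_norm x : `|sin x| <= `|x|.
Proof.
wlog x0 : x / 0 <= x => [h|].
  have [/h//|x0] := leP 0 x.
  by rewrite -normrN -sinN -(normrN x) h// oppr_ge0 ltW.
have [|c _] := @MVT_segment R sin cos 0 x x0 (fun y _ => is_derive_sin y).
  exact: continuous_subspaceT (@continuous_sin R).
rewrite sin0 !subr0 => ->.
by rewrite normrM ler_piMl ?cos_max.
Qed.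

Lemma cos_sub1_le x : `|cos x - 1| <= `|x|.
Proof.
wlog x0 : x / 0 <= x => [h|].
  have [/h//|x0] := leP 0 x.
  by rewrite -cosN -(normrN x) h// oppr_ge0 ltW.
have [|c _] := @MVT_segment R cos (fun y => - sin y) 0 x x0 (fun y _ => is_derive_cos y).
  exact: continuous_subspaceT (@continuous_cos R).
rewrite cos0 !subr0 => ->.
by rewrite normrM normrN ler_piMl ?sin_max.
Qed.

(** Mean value theorem, with the derivative bounded by [sin_le_norm]. *)
Lemma cos_sub1_le_sqr x : `|cos x - 1| <= x ^+ 2.
Proof.
wlog x0 : x / 0 <= x => [h|].
  have [/h//|x0] := leP 0 x.
  by rewrite -cosN -sqrrN h// oppr_ge0 ltW.
have [|c /itvP hc] := @MVT_segment R cos (fun y => - sin y) 0 x x0 (fun y _ => is_derive_cos y).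
  exact: continuous_subspaceT (@continuous_cos R).
rewrite cos0 !subr0 => ->.
rewrite normrM normrN expr2 (ger0_norm x0) ler_wpM2r//.
by rewrite (le_trans (sin_le_norm _))// ger0_norm// hc.
Qed.

Lemma sin_sub_le_sqr x : `|sin x - x| <= x ^+ 2.
Proof.
wlog x0 : x / 0 <= x => [h|].
  have [/h//|x0] := leP 0 x.
  have := h (- x); rewrite sinN sqrrN oppr_ge0 -opprD normrN; apply.
  exact: ltW.
have [|c /itvP hc] := @MVT_segment R sin cos 0 x x0 (fun y _ => is_derive_sin y).
  exact: continuous_subspaceT (@continuous_sin R).
rewrite sin0 !subr0 => ->.
rewrite -{2}(mul1r x) -mulrBl normrM expr2 (ger0_norm x0) ler_wpM2r//.
by rewrite (le_trans (cos_sub1_le _))// ger0_norm// hc.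
Qed.

Lemma expR_sub1_le x : `|expR x - 1| <= `|x| * expR `|x|.
Proof.
have [x0|x0] := leP 0 x.
  rewrite (ger0_norm x0) ger0_norm ?subr_ge0 ?expR_ge1//; last first.
    by rewrite -expR0 ler_expR.
  have := expR_ge1Dx (- x); rewrite expRN => h.
  have e0 := expR_gt0 x.
  have : (1 - x) * expR x <= 1 by rewrite -ler_pdivlMr// mul1r.
  lra.
have h1 := expR_ge1Dx x.
rewrite ler0_norm; last by rewrite subr_le0 expR_le1 ltW.
rewrite ltr0_norm//.
have h2 : 1 <= expR (- x) by rewrite -expR0 ler_expR; lra.
nra.
Qed.

Lemma expR_taylor1 x : `|expR x - 1 - x| <= x ^+ 2 * expR `|x|.
Proof.
have h0 : 0 <= expR x - 1 - x by have := expR_ge1Dx x; lra.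
rewrite ger0_norm//.
have h : expR x - 1 - x <= x * (expR x - 1).
  have := expR_ge1Dx (- x); rewrite expRN => h.
  have e0 := expR_gt0 x.
  have : (1 - x) * expR x <= 1 by rewrite -ler_pdivlMr// mul1r.
  lra.
apply: (le_trans h); apply: (le_trans (ler_norm _)); rewrite normrM.
rewrite -(real_normK (num_real x)) expr2 -mulrA ler_wpM2l//.
exact: expR_sub1_le.
Qed.

(** The real and imaginary parts of e^a (cos b + i sin b) - 1 - a - ib are split
into the one-variable remainders of exp, cos and sin. *)
Lemma cexp_taylor1 z : cabs (cexp z - 1 - z) <= 4 * expR (cabs z) * cabs z ^+ 2.
Proof.
rewrite cexpE; have := Re_le_cabs z; have := Im_le_cabs z.
have := cabs_ge0 z; move: (cabs z) => K K0; case: z => a b /= hb ha.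
have eK : expR `|a| <= expR K by rewrite ler_expR.
have ea : expR a <= expR K by rewrite ler_expR (le_trans (ler_norm _)).
have e0 : 0 < expR a := expR_gt0 a.
have a2 : a ^+ 2 <= K ^+ 2 by rewrite -(real_normK (num_real a)) ler_sqr ?nnegrE.
have b2 : b ^+ 2 <= K ^+ 2 by rewrite -(real_normK (num_real b)) ler_sqr ?nnegrE.
apply: (le_trans (cabs_le_ReIm _)) => /=.
have hR : `|expR a * cos b - 1 - a| <= 2 * expR K * K ^+ 2.
  have -> : expR a * cos b - 1 - a = expR a * (cos b - 1) + (expR a - 1 - a) by ring.
  apply: (le_trans (ler_normD _ _)); rewrite normrM (gtr0_norm e0).
  have := expR_taylor1 a; have := cos_sub1_le_sqr b => h1 h2.
  have h3 : expR a * `|cos b - 1| <= expR K * K ^+ 2.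
    by rewrite ler_pM// ?(ltW e0)// (le_trans h1).
  have h4 : a ^+ 2 * expR `|a| <= K ^+ 2 * expR K.
    by rewrite ler_pM// ?sqr_ge0 ?expR_ge0.
  lra.
have hI : `|expR a * sin b - 0 - b| <= 2 * expR K * K ^+ 2.
  have -> : expR a * sin b - 0 - b = expR a * (sin b - b) + (expR a - 1) * b by ring.
  apply: (le_trans (ler_normD _ _)); rewrite !normrM (gtr0_norm e0).
  have := expR_sub1_le a; have := sin_sub_le_sqr b => h1 h2.
  have h3 : expR a * `|sin b - b| <= expR K * K ^+ 2.
    by rewrite ler_pM// ?(ltW e0)// (le_trans h1).
  have h4 : `|expR a - 1| * `|b| <= K * expR K * K.
    rewrite ler_pM// (le_trans h2)//.
    by rewrite ler_pM// expR_ge0.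
  have -> : 2 * expR K * K ^+ 2 = expR K * K ^+ 2 + K * expR K * K by ring.
  exact: lerD.
have -> : 4 * expR K * K ^+ 2 = 2 * expR K * K ^+ 2 + 2 * expR K * K ^+ 2 by ring.
exact: lerD.
Qed.

End ComplexModulus.

(** * Sums weighted by the growth of the cluster *)

Section CapacitySums.
Context {R : realType} (alpha c : R).
Hypothesis (alpha_gt0 : 0 < alpha) (alpha_lt2 : alpha < 2) (c_gt0 : 0 < c).

Local Notation a := (capacity alpha c).
Let T (k : nat) : R := 1 + alpha * c * k%:R.

(** The logarithm of the dilation produced by the maps k, ..., n-1. *)
Definition tail_capacity (n k : nat) : R := \sum_(k <= i < n) a i.
Local Notation S := tail_capacity.

Let T_gt0 k : 0 < T k.
Proof. by rewrite ltr_pwDl// mulr_ge0// mulr_ge0// ltW. Qed.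

Let T_ge1 k : 1 <= T k.
Proof. by rewrite lerDl mulr_ge0// mulr_ge0// ltW. Qed.

Lemma capacity_gt0 k : 0 < a k.
Proof. by rewrite divr_gt0// T_gt0. Qed.

Lemma capacity_le k : a k <= c.
Proof. by rewrite ler_pdivrMr ?T_gt0// ler_peMr ?T_ge1// ltW. Qed.

Let TS k : T k.+1 = T k * (1 + alpha * a k).
Proof.
have t0 := lt0r_neq0 (T_gt0 k).
have -> : T k * (1 + alpha * a k) = T k + alpha * c.
  by rewrite /capacity -/(T k); move: (T k) t0 => t t0; field.
by rewrite /T -natr1; ring.
Qed.

Lemma tail_capacity_nn n : S n n = 0.
Proof. by rewrite /tail_capacity big_geq. Qed.

Lemma tail_capacityS n k : (k < n)%N -> S n k = a k + S n k.+1.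
Proof. by move=> kn; rewrite /tail_capacity big_ltn. Qed.

Lemma tail_capacity_ge0 n k : 0 <= S n k.
Proof. by apply: sumr_ge0 => i _; rewrite ltW// capacity_gt0. Qed.

(** A sum is bounded by comparison with the increments of a function b; the three
bounds on weighted capacities below are instances, with b built from
exp(- S n k) and T k. *)
Lemma sum_le_telescope (C : R) (u b : nat -> R) (n : nat) : 0 <= C -> 0 <= b 0%N ->
  (forall k, (k < n)%N -> u k <= C * (b k.+1 - b k)) ->
  \sum_(0 <= k < n) u k <= C * b n.
Proof.
move=> C0 b0 h; apply: (@le_trans _ _ (\sum_(0 <= k < n) C * (b k.+1 - b k))).
  by rewrite ler_sum_nat// => k /andP[_ /h].
by rewrite -mulr_sumr telescope_sumr// ler_wpM2l// lerBlDr lerDl.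
Qed.

Let expRN_sub_ge x (q : R) : 0 <= x <= c -> 0 <= q <= 1 ->
  q * x * expR (- c) <= expR (- ((1 - q) * x)) - expR (- x).
Proof.
move=> /andP[x0 xc] /andP[q0 q1].
have -> : - ((1 - q) * x) = q * x + - x by ring.
rewrite expRD -[X in _ <= _ - X]mul1r -mulrBl.
have h1 := expR_ge1Dx (q * x).
have h2 : expR (- c) <= expR (- x) by rewrite ler_expR lerN2.
by rewrite ler_pM// ?expR_ge0 ?mulr_ge0//; lra.
Qed.

(** Telescopes against exp(- S n k), which increases from a positive value at
k = 0 to 1 at k = n. *)
Lemma sum_capacity_tail_le n :
  \sum_(0 <= k < n) expR (- S n k.+1) * a k <= expR c.
Proof.
have := @sum_le_telescope (expR c) (fun k => expR (- S n k.+1) * a k)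
  (fun k => expR (- S n k)) n (expR_ge0 _) (expR_ge0 _).
rewrite tail_capacity_nn oppr0 expR0 mulr1; apply => k kn.
rewrite (tail_capacityS kn) opprD expRD -[X in X - _]mul1r -mulrBl.
have -> : forall E e : R, expR c * ((1 - e) * E) = E * (expR c * (1 - e)) by move=> *; ring.
rewrite ler_wpM2l ?expR_ge0//.
have := @expRN_sub_ge (a k) 1; rewrite subrr mul0r oppr0 expR0 mul1r.
rewrite (ltW (capacity_gt0 _)) capacity_le ler01 lexx => /(_ isT isT).
by rewrite expRN ler_pdivrMr ?expR_gt0// mulrC.
Qed.

Let kap := expR c / (1 - alpha / 2).
Let kap_gt0 : 0 < kap.
Proof.
have a2 : 0 < 1 - alpha / 2 by move: alpha_lt2; lra.
by rewrite divr_gt0 ?expR_gt0.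
Qed.

(** The increment of exp(- S n k) / sqrt (T k) over one step is positive because
(1 + alpha x)^(-1/2) >= exp(- alpha x / 2) and alpha / 2 < 1. *)
Let inv_sqrt_sub_ge x : 0 <= x <= c ->
  x <= kap * ((Num.sqrt (1 + alpha * x))^-1 - expR (- x)).
Proof.
move=> xc; have /andP[x0 _] := xc.
have ax : 0 <= alpha * x by rewrite mulr_ge0// ltW.
have h1 : expR (- ((1 - (1 - alpha / 2)) * x)) <= (Num.sqrt (1 + alpha * x))^-1.
  rewrite expRN lef_pV2 ?posrE ?expR_gt0// ?sqrtr_gt0 ?ltr_pwDl//.
  rewrite -[leRHS]ger0_norm ?expR_ge0// -sqrtr_sqr ler_wsqrtr//.
  rewrite -expRM_natl (le_trans (expR_ge1Dx _))// ler_expR.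
  by rewrite le_eqVlt; apply/orP; left; apply/eqP; field.
have := expRN_sub_ge xc; move=> /(_ (1 - alpha / 2)) h2.
have a2 : 0 < 1 - alpha / 2 by move: alpha_lt2; lra.
have a2' : 1 - alpha / 2 <= 1 by move: alpha_gt0; lra.
have {}h2 : (1 - alpha / 2) * x * expR (- c) <= (Num.sqrt (1 + alpha * x))^-1 - expR (- x).
  by rewrite (le_trans (h2 _))//; [rewrite (ltW a2)|rewrite lerD2r].
rewrite /kap mulrAC ler_pdivlMr// mulrC -ler_pdivrMl ?expR_gt0//.
by rewrite -expRN [leLHS]mulrC.
Qed.

(** Telescopes against exp(- S n k) / sqrt (T k), whose value at k = n is
1 / sqrt (T n). *)
Lemma sum_capacity32_tail_le : exists2 C : R, 0 < C & forall n, (0 < n)%N ->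
  \sum_(0 <= k < n) expR (- S n k.+1) * (a k * Num.sqrt (a k)) <= C / Num.sqrt n%:R.
Proof.
exists (kap * Num.sqrt c / Num.sqrt (alpha * c)).
  apply: divr_gt0; first by rewrite mulr_gt0 ?sqrtr_gt0.
  by rewrite sqrtr_gt0 mulr_gt0.
move=> n n0.
have := @sum_le_telescope (kap * Num.sqrt c)
  (fun k => expR (- S n k.+1) * (a k * Num.sqrt (a k)))
  (fun k => expR (- S n k) / Num.sqrt (T k)) n.
rewrite mulr_ge0 ?(ltW kap_gt0) ?sqrtr_ge0// divr_ge0 ?expR_ge0 ?sqrtr_ge0//.
rewrite tail_capacity_nn oppr0 expR0 mul1r => /(_ isT isT) h.
apply: le_trans (h _) _.
  move=> k kn; have a0 := capacity_gt0 k; have t0 := T_gt0 k.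
  rewrite (tail_capacityS kn) opprD expRD TS (@sqrtrM _ (T k)) ?(ltW t0)// (@invfM _ (Num.sqrt (T k))).
  have -> : Num.sqrt (a k) = Num.sqrt c / Num.sqrt (T k).
    by rewrite /capacity -/(T k) sqrtrM ?ltW// sqrtrV// ltW.
  have := @inv_sqrt_sub_ge (a k); rewrite (ltW a0) capacity_le => /(_ isT) h1.
  have -> : forall E e s t u : R, kap * s * (E * (t * u) - e * E * t) =
     E * (kap * (u - e) * (s * t)) by move=> *; ring.
  by rewrite ler_wpM2l ?expR_ge0// ler_wpM2r// mulr_ge0 ?invr_ge0 ?sqrtr_ge0.
have ac0 : 0 < alpha * c by rewrite mulr_gt0.
have -> : forall x y z : R, x / y / z = x * (y * z)^-1 by move=> *; rewrite invfM mulrA.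
rewrite ler_wpM2l//; first by rewrite mulr_ge0 ?sqrtr_ge0 ?(ltW kap_gt0).
rewrite -sqrtrM ?(ltW ac0)// lef_pV2 ?posrE ?sqrtr_gt0 ?mulr_gt0 ?ltr0n//.
by rewrite ler_wsqrtr// lerDr ler01.
Qed.

Let inv_sub_ge x : 0 <= x <= c ->
  x <= expR (2 * c) / (2 - alpha) * ((1 + alpha * x)^-1 - expR (- (2 * x))).
Proof.
move=> /andP[x0 xc].
have a2 : 0 < 2 - alpha by rewrite subr_gt0.
have ax : 0 <= alpha * x by rewrite mulr_ge0// ltW.
have h1 : expR (- (alpha * x)) <= (1 + alpha * x)^-1.
  by rewrite expRN lef_pV2 ?posrE ?expR_gt0// ?ltr_pwDl// expR_ge1Dx.
have h2 : (2 - alpha) * x * expR (- (2 * c)) <= expR (- (alpha * x)) - expR (- (2 * x)).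
  have -> : - (alpha * x) = (2 - alpha) * x + - (2 * x) by ring.
  rewrite expRD -[X in _ <= _ - X]mul1r -mulrBl.
  have h1' := expR_ge1Dx ((2 - alpha) * x).
  have h2 : expR (- (2 * c)) <= expR (- (2 * x)) by rewrite ler_expR lerN2; lra.
  by rewrite ler_pM// ?expR_ge0 ?mulr_ge0 ?(ltW a2)//; lra.
rewrite mulrAC ler_pdivlMr// mulrC -ler_pdivrMl ?expR_gt0//.
by rewrite -expRN [leLHS]mulrC (le_trans h2)// lerD2r.
Qed.

(** Telescopes against exp(- 2 S n k) / T k, whose value at k = n is 1 / T n. *)
Lemma sum_sqr_capacity_tail_le : exists2 C : R, 0 < C & forall n, (0 < n)%N ->
  \sum_(0 <= k < n) (expR (- S n k.+1) * a k) ^+ 2 <= C / n%:R.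
Proof.
have a2 : 0 < 2 - alpha by rewrite subr_gt0.
pose K := expR (2 * c) / (2 - alpha).
have K0 : 0 < K by rewrite divr_gt0 ?expR_gt0.
have ac0 : 0 < alpha * c by rewrite mulr_gt0.
exists (K * c / (alpha * c)); first by apply: divr_gt0 => //; apply: mulr_gt0.
move=> n n0.
have := @sum_le_telescope (K * c)
  (fun k => (expR (- S n k.+1) * a k) ^+ 2)
  (fun k => expR (- S n k) ^+ 2 / T k) n.
have Kc0 : 0 <= K * c by apply: mulr_ge0; exact: ltW.
rewrite Kc0 divr_ge0 ?exprn_ge0 ?expR_ge0 ?(ltW (T_gt0 _))//.
rewrite tail_capacity_nn oppr0 expR0 expr1n mul1r => /(_ isT isT) h.
apply: le_trans (h _) _.
  move=> k kn; have a0 := capacity_gt0 k; have t0 := T_gt0 k.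
  rewrite (tail_capacityS kn) opprD expRD TS (@invfM _ (T k)).
  have -> : forall E, (E * a k) ^+ 2 = E ^+ 2 * (a k * (c / T k)).
    by move=> E; rewrite expr2 mulrACA -expr2.
  have -> : forall E, (expR (- a k) * E) ^+ 2 = expR (- (2 * a k)) * E ^+ 2.
    by move=> E; rewrite expr2 mulrACA -expRD -expr2; congr (expR _ * _); ring.
  have := @inv_sub_ge (a k); rewrite (ltW a0) capacity_le => /(_ isT) h1.
  have -> : forall E e s t u : R, K * s * (E * (t * u) - e * E * t) =
     E * (K * (u - e) * (s * t)) by move=> *; ring.
  by rewrite ler_wpM2l ?exprn_ge0 ?expR_ge0// ler_wpM2r// divr_ge0// ltW.
have -> : forall x y z : R, x / y / z = x * (y * z)^-1 by move=> *; rewrite invfM mulrA.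
rewrite ler_wpM2l//.
rewrite lef_pV2 ?posrE ?mulr_gt0 ?ltr0n//.
by rewrite lerDr ler01.
Qed.

End CapacitySums.

(** * One particle *)

Section ParticleStep.
Local Open Scope complex_scope.
Context {R : realType}.

Lemma powR32 (a : R) : 0 < a -> a `^ (3 / 2) = a * Num.sqrt a.
Proof.
move=> a0; have -> : 3 / 2 = 1 + 2^-1 :> R by field.
rewrite powRD; last by rewrite (gt_eqF a0) implybT.
by rewrite powRr1 ?(ltW a0)// powR12_sqrt// ltW.
Qed.

(** The map is w |-> e^a w exp(x) with x = 2a / (u - 1) + delta and u the rotated
point.  Both delta and the terms of second order in x are O(a^(3/2)) / |w|: away
from the unit circle, |u - 1| and |w| - 1 are comparable to |w|, so that
|x| = O(a) / |w|. *)
Lemma rotated_step (c lambda rr : R) : 0 < c -> 0 <= lambda -> 1 < rr ->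
  exists2 C : R, 0 < C & forall f delta, particle_estimate c lambda f delta ->
  forall a t (w : R[i]), 0 < a <= c -> rr <= cabs w ->
  cabs ((expR (- a))%:C * rotated (f a) t w - w
        - (2 * a)%:C * w / (w * cexp (- t%:C * 'i) - 1)) <= C * (a * Num.sqrt a).
Proof.
move=> c0 l0 r1.
have r10 : 0 < rr - 1 by rewrite subr_gt0.
have rr0 : 0 < rr by rewrite (lt_trans ltr01).
(* rho / |w| bounds both 1 / (|w| - 1) and 1 / |u - 1| when |w| >= rr *)
have [rho rhoE] : {rho | rho = rr / (rr - 1)} by eexists.
have rho0 : 0 < rho by rewrite rhoE divr_gt0.
have [K KE] : {K | K = 2 * rho + lambda * rho ^+ 2 * Num.sqrt c} by eexists.
have lr0 : 0 <= lambda * rho ^+ 2 by rewrite mulr_ge0 ?sqr_ge0.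
have K0 : 0 < K.
  by rewrite KE; apply: ltr_wpDr; [rewrite mulr_ge0 ?sqrtr_ge0|rewrite mulr_gt0].
have [C1 C1E] : {C1 | C1 = 4 * expR (K * c) * K ^+ 2 * Num.sqrt c} by eexists.
have C10 : 0 < C1 by rewrite C1E !mulr_gt0// ?expR_gt0 ?exprn_gt0 ?sqrtr_gt0.
exists (C1 + lambda * rho ^+ 2).
  exact: ltr_wpDr.
move=> f delta hf a t w /andP[a0 ac] hw.
have W1 : 1 < cabs w by rewrite (lt_le_trans r1).
have W0 : 0 < cabs w by rewrite (lt_trans ltr01).
pose u := w * cexp (- t%:C * 'i).
have cu : cabs u = cabs w by rewrite cabsM cabs_rotN mulr1.
have ru : cexp (t%:C * 'i) * u = w.
  rewrite /u cexp_rotN mulrCA mulfV ?mulr1//.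
  by rewrite -cabs_gt0 cabs_rot.
have u1 : cabs w - 1 <= cabs (u - 1).
  by rewrite -cu -[X in _ - X](@cabs1 R) cabsB_ge.
have W10 : 0 < cabs w - 1 by rewrite subr_gt0.
have Wr : (cabs w - 1)^-1 <= rho / cabs w.
  rewrite ler_pdivlMr// mulrC ler_pdivrMr// rhoE mulrAC ler_pdivlMr//.
  by nra.
have u10 : 0 < cabs (u - 1) by rewrite (lt_le_trans _ u1).
have Ur : (cabs (u - 1))^-1 <= rho / cabs w.
  by rewrite (le_trans _ Wr)// lef_pV2 ?posrE.
have [||fe hd] := hf a u; first by rewrite a0.
  by rewrite /exterior_disc/= cu.
set d := delta a u in fe hd.
pose x := (2 * a)%:C / (u - 1) + d.
have d_le : cabs d * cabs w <= lambda * rho ^+ 2 * (a * Num.sqrt a).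
  have : cabs d <= lambda * (a * Num.sqrt a) * cabs w * (rho / cabs w * (rho / cabs w)).
    rewrite (le_trans (ltW hd))// powR32// cu invfM ler_wpM2l//.
      by rewrite !mulr_ge0 ?cabs_ge0 ?(ltW a0) ?sqrtr_ge0.
    by rewrite ler_pM ?invr_ge0 ?cabs_ge0// ltW.
  have -> : lambda * (a * Num.sqrt a) * cabs w * (rho / cabs w * (rho / cabs w)) =
     lambda * rho ^+ 2 * (a * Num.sqrt a) / cabs w.
    by move/lt0r_neq0 : W0 => W0; field.
  by rewrite ler_pdivlMr.
have sac : Num.sqrt a <= Num.sqrt c by rewrite ler_wsqrtr.
have x_le : cabs x * cabs w <= K * a.
  rewrite (le_trans (ler_wpM2r (ltW W0) (cabsD _ _)))// mulrDl.
  have h1 : cabs ((2 * a)%:C / (u - 1)) * cabs w <= 2 * rho * a.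
    rewrite cabsM cabsV cabs_real gtr0_norm ?mulr_gt0//.
    rewrite -ler_pdivlMr//.
    have -> : 2 * rho * a / cabs w = 2 * a * (rho / cabs w) by ring.
    by rewrite ler_wpM2l// mulr_ge0// ltW.
  have h2 : lambda * rho ^+ 2 * (a * Num.sqrt a) <= lambda * rho ^+ 2 * Num.sqrt c * a.
    by rewrite -[leRHS]mulrA ler_wpM2l// [leRHS]mulrC ler_wpM2l// ltW.
  by rewrite KE (mulrDl (2 * rho)) lerD// (le_trans d_le).
have xKc : cabs x <= K * c.
  have : K * a <= K * c by rewrite ler_wpM2l// ltW.
  have : cabs x <= cabs x * cabs w by rewrite ler_peMr ?cabs_ge0// ltW.
  lra.
have -> : (expR (- a))%:C * rotated (f a) t w - w
        - (2 * a)%:C * w / (w * cexp (- t%:C * 'i) - 1) =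
        w * (cexp x - 1 - x) + w * d.
  rewrite /rotated -/u fe.
  have -> : (expR (- a))%:C * (cexp (t%:C * 'i) *
     ((expR a)%:C * u * cexp ((2 * a)%:C / (u - 1) + d))) =
     ((expR (- a))%:C * (expR a)%:C) * (cexp (t%:C * 'i) * u) * cexp x.
    by rewrite /x; ring.
  rewrite ru -rmorphM/= -expRD addNr expR0 mul1r /x.
  ring.
rewrite (le_trans (cabsD _ _))// mulrDl lerD//; last first.
  by rewrite cabsM mulrC.
rewrite cabsM.
have h := cexp_taylor1 x.
have h1 : cabs w * (4 * expR (cabs x) * cabs x ^+ 2) <= 4 * expR (K * c) * (K * a) ^+ 2.
  have -> : cabs w * (4 * expR (cabs x) * cabs x ^+ 2) =
     4 * expR (cabs x) * (cabs x * (cabs x * cabs w)) by ring.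
  rewrite ler_pM//.
  - by rewrite !mulr_ge0 ?cabs_ge0.
  - by rewrite ler_wpM2l ?ler_expR.
  rewrite expr2 ler_pM ?mulr_ge0 ?cabs_ge0//.
  by rewrite (le_trans _ x_le)// ler_peMr ?cabs_ge0// ltW.
have h2 : a ^+ 2 <= Num.sqrt c * (a * Num.sqrt a).
  rewrite mulrCA expr2 ler_wpM2l ?(ltW a0)//.
  by rewrite -{1}(sqr_sqrtr (ltW a0)) expr2 ler_wpM2r// sqrtr_ge0.
apply: le_trans (ler_wpM2l (ltW W0) h) _.
apply: (le_trans h1).
have -> : C1 * (a * Num.sqrt a) = 4 * expR (K * c) * K ^+ 2 * (Num.sqrt c * (a * Num.sqrt a)).
  by rewrite C1E; ring.
rewrite exprMn mulrA ler_wpM2l//.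
by apply: mulr_ge0; rewrite ?sqr_ge0// mulr_ge0 ?expR_ge0.
Qed.

End ParticleStep.

(** * The composed maps and their linearization *)

Section Deterministic.
Local Open Scope complex_scope.
Context {R : realType} (alpha c : R).
Implicit Types (f : R -> R[i] -> R[i]) (theta : nat -> R) (z : R[i]).

Local Notation a := (capacity alpha c).
Local Notation S := (tail_capacity alpha c).

(** Indexed by the last map applied, so that the orbit starts at k = n and the
recursion in [inner_orbitS] runs downwards. *)
Definition inner_orbit f theta (n : nat) z (k : nat) : R[i] :=
  foldr (fun i => rotated (f (a i)) (theta i)) z (index_iota k n).

Lemma inner_orbit_nn f theta n z : inner_orbit f theta n z n = z.
Proof. by rewrite /inner_orbit /index_iota subnn. Qed.

Lemma inner_orbitS f theta n z k : (k < n)%N ->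
  inner_orbit f theta n z k =
  rotated (f (a k)) (theta k) (inner_orbit f theta n z k.+1).
Proof. by move=> kn; rewrite /inner_orbit /index_iota -subnSK. Qed.

Lemma cluster_map_orbit f theta n z :
  cluster_map alpha c f theta n z = inner_orbit f theta n z 0.
Proof.
rewrite /inner_orbit /index_iota subn0.
elim: n z => [//|n IH] z; rewrite -addn1 iotaD foldr_cat add0n /= addn1 /=.
by rewrite IH.
Qed.

Definition normalized_orbit f theta n z k : R[i] :=
  (expR (- S n k))%:C * inner_orbit f theta n z k.

(** The first-order term of step i along the deterministic orbit
exp(S n (i+1)) z in place of the true one. *)
Definition fluctuation theta n z i : R[i] :=
  (2 * a i)%:C * z / ((expR (S n i.+1))%:C * z * cexp (- (theta i)%:C * 'i) - 1).

(** The contribution of step i to the coefficient of z^(1-m) in the expansion of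
the fluctuation at infinity. *)
Definition harmonic theta n m i : R[i] :=
  (2 * a i * expR (- S n i.+1) ^+ m)%:C * cexp ((theta i)%:C * 'i) ^+ m.

Hypothesis (alpha_gt0 : 0 < alpha) (alpha_lt2 : alpha < 2) (c_gt0 : 0 < c).

Lemma sum_tail_le (u : nat -> R) k n : (forall i, 0 <= u i) ->
  \sum_(k <= i < n) u i <= \sum_(0 <= i < n) u i.
Proof.
move=> u0; have [kn|nk] := leqP k n; last first.
  by rewrite big_geq 1?ltnW// sumr_ge0.
by rewrite (big_cat_nat (leq0n k) kn)/= lerDr sumr_ge0.
Qed.

(** The difference of the two quotients is
(w' - w) / ((w e - 1) (w' e - 1)). *)
Lemma subr_inv_rot (w w' e : R[i]) : cabs e = 1 -> 1 < cabs w -> 1 < cabs w' ->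
  cabs (w / (w * e - 1) - w' / (w' * e - 1)) <=
  cabs (w - w') / ((cabs w - 1) * (cabs w' - 1)).
Proof.
move=> e1 w1 w'1.
have h v : 1 < cabs v -> cabs v - 1 <= cabs (v * e - 1).
  move=> v1; apply: le_trans (cabsB_ge _ _).
  by rewrite cabsM e1 mulr1 cabs1.
have p v : 1 < cabs v -> 0 < cabs (v * e - 1).
  by move=> v1; rewrite (lt_le_trans _ (h _ v1))// subr_gt0.
have := p _ w1; have := p _ w'1; rewrite !cabs_gt0 => n' n.
have -> : w / (w * e - 1) - w' / (w' * e - 1) =
  (w' - w) / ((w * e - 1) * (w' * e - 1)) by field; rewrite n' n.
rewrite cabsM cabsV cabsM cabsC ler_wpM2l ?cabs_ge0//.
rewrite lef_pV2 ?posrE ?mulr_gt0 ?p ?subr_gt0//.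
by rewrite ler_pM ?h// subr_ge0 ltW.
Qed.

(** Discrete Gronwall inequality.  Write y k for M k - z minus the partial sum A k of
the fluctuations.  One step replaces y (k+1) by y k at the price of q k, the error
of [rotated_step], and g k |M (k+1) - z|, the cost of moving the base point from
the true orbit to the deterministic one; the sums of q and g are O(n^(-1/2)) and
O(1).  The smallness assumption on the final bound keeps |M k| >= (r + 1) / 2 all
along the induction, which is what the one-step estimate requires. *)
Lemma normalized_deviation_le (lambda r : R) : 0 <= lambda -> 1 < r ->
  exists2 K : R, 0 < K & forall f delta, particle_estimate c lambda f delta ->
  forall theta n t z, (0 < n)%N -> r <= cabs z ->
    (forall k, (k <= n)%N -> cabs (\sum_(k <= i < n) fluctuation theta n z i) <= t) ->
    K * (t + (Num.sqrt n%:R)^-1) <= (r - 1) / 2 ->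
  cabs ((expR (- S n 0%N))%:C * cluster_map alpha c f theta n z - z)
    <= K * (t + (Num.sqrt n%:R)^-1).
Proof.
move=> l0 r1; have r10 : 0 < r - 1 by rewrite subr_gt0.
(* half-way between r and 1: the orbit never goes below this modulus *)
have [rr rrE] : {rr | rr = (r + 1) / 2} by eexists.
have rr1 : 1 < rr by rewrite rrE; lra.
have [C C0 hstep] := rotated_step c_gt0 l0 rr1.
have [Q Q0 hQ] := sum_capacity32_tail_le alpha_gt0 alpha_lt2 c_gt0.
have [G GE] : {G | G = 2 / ((rr - 1) * (r - 1))} by eexists.
have G0 : 0 < G by rewrite GE divr_gt0// mulr_gt0// subr_gt0.
exists (expR (G * expR c) * (1 + C * Q)).
  by rewrite mulr_gt0 ?expR_gt0// addr_gt0// mulr_gt0.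
set K := _ * (1 + _).
move=> f delta hf theta n t z n0 rz hA hK.
have t0 : 0 <= t by rewrite (le_trans _ (hA n (leqnn n)))// cabs_ge0.
pose g i := G * (expR (- S n i.+1) * a i).
pose q i := C * (expR (- S n i.+1) * (a i * Num.sqrt (a i))).
pose A k := \sum_(k <= i < n) fluctuation theta n z i.
pose M := normalized_orbit f theta n z.
pose y k := M k - z - A k.
have ap i : 0 < a i := capacity_gt0 alpha_gt0 c_gt0 i.
have ap0 i : 0 <= a i := ltW (ap i).
have g0 i : 0 <= g i.
  by apply: mulr_ge0 (ltW G0) _; apply: mulr_ge0 (expR_ge0 _) (ap0 i).
have q0 i : 0 <= q i.
  apply: mulr_ge0 (ltW C0) _; apply: mulr_ge0 (expR_ge0 _) _.
  exact: mulr_ge0 (ap0 i) (sqrtr_ge0 _).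
have hfin k : expR (\sum_(k <= i < n) g i) * (t + \sum_(k <= i < n) q i)
    <= K * (t + (Num.sqrt n%:R)^-1).
  rewrite /K -mulrA ler_pM ?expR_ge0//.
  - by rewrite addr_ge0// sumr_ge0.
  - rewrite ler_expR (le_trans (sum_tail_le _ _ g0))// /g -mulr_sumr.
    by rewrite ler_wpM2l ?(ltW G0) ?sum_capacity_tail_le.
  have h : \sum_(k <= i < n) q i <= C * Q / Num.sqrt n%:R.
    rewrite (le_trans (sum_tail_le _ _ q0))// /q -mulr_sumr -mulrA.
    by rewrite ler_wpM2l ?(ltW C0) ?hQ.
  have h1 : 0 <= (Num.sqrt n%:R)^-1 :> R by rewrite invr_ge0 sqrtr_ge0.
  have h2 : 0 <= C * Q by rewrite mulr_ge0// ltW.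
  by nra.
(* downward induction on k = n - j *)
have key j : (j <= n)%N -> let k := (n - j)%N in
    cabs (y k) + t <= expR (\sum_(k <= i < n) g i) * (t + \sum_(k <= i < n) q i).
  elim: j => [_|j IH jn] /=.
    rewrite subn0 /y /A !big_geq// expR0 mul1r addr0 subr0 /M.
    rewrite /normalized_orbit inner_orbit_nn tail_capacity_nn oppr0 expR0 mul1r.
    by rewrite subrr cabs0 add0r.
  have := IH (ltnW jn) => /= {}IH.
  have kE : (n - j = (n - j.+1).+1)%N by rewrite subnS prednK// subn_gt0.
  move: (n - j.+1)%N kE (leq_subr j.+1 n) (leq_subr j n) => k kE _.
  rewrite kE in IH * => kn.
  pose w := inner_orbit f theta n z k.+1.
  have Mz : cabs (M k.+1 - z) <= cabs (y k.+1) + t.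
    have -> : M k.+1 - z = y k.+1 + A k.+1 by rewrite /y subrK.
    by rewrite (le_trans (cabsD _ _))// lerD2l hA.
  have S0 : 1 <= expR (S n k.+1).
    by rewrite -expR0 ler_expR tail_capacity_ge0.
  have SN : expR (- S n k.+1) * expR (S n k.+1) = 1.
    by rewrite -expRD addNr expR0.
  have Mw : (expR (S n k.+1))%:C * M k.+1 = w.
    by rewrite /M /normalized_orbit mulrA -rmorphM/= (mulrC (expR _)) SN mul1r.
  have Mrr : rr <= cabs (M k.+1).
    have h1 : cabs z <= cabs (M k.+1) + cabs (M k.+1 - z).
      by rewrite cabsC -lerBlDl (le_trans (cabsB_ge _ _)).
    have h2 := le_trans (le_trans Mz IH) (le_trans (hfin _) hK).
    by rewrite rrE; lra.
  have wrr : rr <= cabs w.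
    rewrite -Mw cabsM cabs_real ger0_norm ?expR_ge0//.
    by rewrite (le_trans Mrr)// ler_peMl ?cabs_ge0.
  pose w' := (expR (S n k.+1))%:C * z.
  have w'r : expR (S n k.+1) * (r - 1) <= cabs w' - 1.
    rewrite cabsM cabs_real ger0_norm ?expR_ge0//; nra.
  have w'1 : 1 < cabs w'.
    by rewrite -subr_gt0 (lt_le_trans _ w'r)// mulr_gt0// expR_gt0.
  pose e := cexp (- (theta k)%:C * 'i).
  have e1 : cabs e = 1 by rewrite cabs_rotN.
  pose err := (expR (- a k))%:C * rotated (f (a k)) (theta k) w - w
        - (2 * a k)%:C * w / (w * e - 1).
  have herr : cabs err <= C * (a k * Num.sqrt (a k)).
    by apply: (hstep f delta hf) => //; rewrite ap capacity_le.
  have yS : y k = y k.+1 + (expR (- S n k.+1))%:C * err +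
     (expR (- S n k.+1))%:C * (2 * a k)%:C * (w / (w * e - 1) - w' / (w' * e - 1)).
    have -> : y k = M k - z - (fluctuation theta n z k + A k.+1).
      by rewrite /y /A [in LHS]big_ltn.
    have -> : M k = (expR (- S n k.+1))%:C * ((expR (- a k))%:C * rotated (f (a k)) (theta k) w).
      rewrite /M /normalized_orbit inner_orbitS// tail_capacityS// mulrA.
      by rewrite -rmorphM/= -expRD opprD [- a k + _]addrC.
    have -> : fluctuation theta n z k =
        (expR (- S n k.+1))%:C * (2 * a k)%:C * (w' / (w' * e - 1)).
      rewrite /fluctuation /w' -/e.
      have -> : forall E E' b v : R[i], E' * b * (E * z / v) = (E' * E) * (b * z / v).
        by move=> *; ring.
      by rewrite -rmorphM/= SN mul1r.
    rewrite /err /y {1}/M /normalized_orbit -/w.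
    ring.
  have hy : cabs (y k) <= cabs (y k.+1) + q k + g k * cabs (M k.+1 - z).
    rewrite yS (le_trans (cabsD _ _))// lerD//.
      rewrite (le_trans (cabsD _ _))// lerD2l cabsM cabs_real.
      rewrite ger0_norm ?expR_ge0// /q [leRHS]mulrCA.
      by rewrite ler_wpM2l ?expR_ge0.
    have hww : cabs (w - w') = expR (S n k.+1) * cabs (M k.+1 - z).
      by rewrite -Mw /w' -mulrBr cabsM cabs_real ger0_norm ?expR_ge0.
    have w1 : 1 < cabs w by rewrite (lt_le_trans rr1).
    have := subr_inv_rot e1 w1 w'1; rewrite hww => h.
    rewrite !cabsM !cabs_real ger0_norm ?expR_ge0// ger0_norm; last first.
      by rewrite mulr_ge0// ltW.
    have h' : expR (S n k.+1) * cabs (M k.+1 - z) / ((cabs w - 1) * (cabs w' - 1))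
       <= cabs (M k.+1 - z) * ((rr - 1) * (r - 1))^-1.
      rewrite ler_pdivrMr ?mulr_gt0 ?subr_gt0//.
      rewrite mulrAC ler_pdivlMr ?mulr_gt0 ?subr_gt0//.
      have -> : forall X m : R, X * m * ((rr - 1) * (r - 1)) =
         m * ((rr - 1) * (X * (r - 1))) by move=> *; ring.
      rewrite ler_wpM2l ?cabs_ge0//.
      rewrite ler_pM ?mulr_ge0 ?expR_ge0 ?subr_ge0 ?(ltW rr1) ?(ltW r1)//.
      by rewrite lerD2r.
    apply: (@le_trans _ _ (expR (- S n k.+1) * (2 * a k) * (cabs (M k.+1 - z) * ((rr - 1) * (r - 1))^-1))).
      apply: ler_wpM2l; last exact: le_trans h h'.
      by apply: mulr_ge0 (expR_ge0 _) _; apply: mulr_ge0 (ap0 k).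
    rewrite /g GE le_eqVlt; apply/orP; left; apply/eqP; ring.
  rewrite [in leRHS]big_ltn// [X in t + X]big_ltn//.
  have hg : 1 + g k <= expR (g k) := expR_ge1Dx _.
  have h3 : g k * cabs (M k.+1 - z) <= g k * (cabs (y k.+1) + t) by rewrite ler_wpM2l.
  have h4 : cabs (y k) + t <= (1 + g k) * (cabs (y k.+1) + t) + q k by lra.
  apply: (le_trans h4).
  have h5 : (1 + g k) * (cabs (y k.+1) + t) <=
     expR (g k) * (expR (\sum_(k.+1 <= i < n) g i) * (t + \sum_(k.+1 <= i < n) q i)).
    by rewrite ler_pM ?addr_ge0 ?cabs_ge0.
  rewrite expRD.
  have h6 : 1 <= expR (g k) * expR (\sum_(k.+1 <= i < n) g i).
    by rewrite -expRD -expR0 ler_expR addr_ge0// sumr_ge0.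
  have h7 := ler_peMl (q0 k) h6.
  lra.
have := key n (leqnn n); rewrite /= subnn => h.
rewrite cluster_map_orbit.
have -> : (expR (- S n 0%N))%:C * inner_orbit f theta n z 0 - z = y 0%N + A 0%N.
  by rewrite /y subrK.
apply: (le_trans (cabsD _ _)).
apply: le_trans (lerD (lexx _) (hA 0%N (leq0n _))) _.
exact: le_trans h (hfin _).
Qed.

End Deterministic.

(** * Harmonics of the fluctuation *)

Section FourierExpansion.
Local Open Scope complex_scope.
Context {R : realType} (alpha c : R).
Implicit Types (theta : nat -> R) (z : R[i]).

Local Notation a := (capacity alpha c).
Local Notation S := (tail_capacity alpha c).

Hypothesis (alpha_gt0 : 0 < alpha) (alpha_lt2 : alpha < 2) (c_gt0 : 0 < c).

Lemma geometric_expansion (q z : R[i]) n : q != 0 -> q != 1 ->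
  z / (q^-1 - 1) = \sum_(j < n) z * q ^+ j.+1 + z * q ^+ n.+1 / (1 - q).
Proof.
move=> q0 q1; have q1' : 1 - q != 0 by rewrite subr_eq0 eq_sym.
have -> : z / (q^-1 - 1) = z * q / (1 - q) by field; rewrite ?q0 ?q1' ?oppr_eq0//=. 
elim: n => [|n IH]; first by rewrite big_ord0 add0r expr1.
rewrite big_ord_recr/= -addrA IH; congr (_ + _).
by rewrite !exprS; field.
Qed.

(** With q = exp(- S n (i+1)) e^(i theta_i) / z the fluctuation is 2 a_i z / (q^-1 - 1),
and |q| <= 1 / |z| < 1; the first N terms of the geometric series are kept. *)
Lemma fluctuation_expansion theta n z i N : 1 < cabs z ->
  exists2 rem : R[i],
    fluctuation alpha c theta n z i =
      \sum_(j < N) (z^-1) ^+ j * harmonic alpha c theta n j.+1 i + rem &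
    cabs rem <= 2 * a i * expR (- S n i.+1) * (cabs z)^-1 ^+ N / (1 - (cabs z)^-1).
Proof.
move=> z1; have z0 : 0 < cabs z by rewrite (lt_trans ltr01).
have z0' : z != 0 by rewrite -cabs_gt0.
pose E := expR (- S n i.+1).
have E1 : E <= 1 by rewrite expR_le1 oppr_le0 tail_capacity_ge0.
have E0 : 0 < E := expR_gt0 _.
have ES : (expR (S n i.+1))%:C = (E%:C)^-1 by rewrite /E expRN fmorphV/= invrK.
have EC0 : E%:C != 0 by rewrite -cabs_gt0 cabs_real gtr0_norm.
have [x xE] : {x | x = cexp ((theta i)%:C * 'i)} by eexists.
have x1 : cabs x = 1 by rewrite xE cabs_rot.
have x0 : x != 0 by rewrite -cabs_gt0 x1.
pose q := E%:C * z^-1 * x.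
have cq : cabs q = E / cabs z by rewrite !cabsM x1 mulr1 cabsV cabs_real gtr0_norm.
have q0 : q != 0 by rewrite !mulf_neq0// invr_neq0.
have cq1 : cabs q <= (cabs z)^-1 by rewrite cq ler_piMl ?invr_ge0 ?cabs_ge0.
have z11 : (cabs z)^-1 < 1 by rewrite invf_lt1.
have q1 : q != 1.
  apply/eqP => q1; move: cq1; rewrite q1 cabs1 => h.
  by have := lt_le_trans z11 h; rewrite ltxx.
have a0 := capacity_gt0 alpha_gt0 c_gt0 i.
have fE : fluctuation alpha c theta n z i = (2 * a i)%:C * (z / (q^-1 - 1)).
  rewrite /fluctuation ES cexp_rotN -xE -mulrA; congr (_ * (_ / (_ - _))).
  by rewrite /q !invfM invrK.
exists ((2 * a i)%:C * (z * q ^+ N.+1 / (1 - q))).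
  rewrite fE (geometric_expansion z N q0 q1) mulrDr; congr (_ + _).
  rewrite mulr_sumr; apply: eq_bigr => j _.
  rewrite /harmonic -/E -xE /q !exprMn (rmorphM _ (2 * a i))/= rmorphXn/= (exprS z^-1).
  by move: (z^-1 ^+ j) (2 * a i)%:C => v u; field.
have -> : cabs ((2 * a i)%:C * (z * q ^+ N.+1 / (1 - q))) =
    2 * a i * (cabs z * cabs q ^+ N.+1 / cabs (1 - q)).
  have a20 : 0 < 2 * a i by apply: mulr_gt0.
  rewrite cabsM cabs_real (gtr0_norm a20) (cabsM _ (1 - q)^-1) cabsV.
  by rewrite (cabsM z) cabsX.
have h1 : cabs z * cabs q ^+ N.+1 <= E * (cabs z)^-1 ^+ N.
  rewrite exprS mulrA cq mulrCA mulfV ?gt_eqF// mulr1 -cq.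
  by rewrite ler_wpM2l ?(ltW E0)// lerXn2r ?nnegrE ?invr_ge0 ?cabs_ge0.
have h2 : (cabs (1 - q))^-1 <= (1 - (cabs z)^-1)^-1.
  have h3 : 1 - (cabs z)^-1 <= cabs (1 - q).
    by rewrite (le_trans _ (cabsB_ge _ _))// cabs1 lerB.
  have h4 : 0 < 1 - (cabs z)^-1 by rewrite subr_gt0.
  by rewrite lef_pV2 ?posrE// (lt_le_trans h4).
have -> : forall p s t u : R, p * s * t * u = p * (s * t * u) by move=> *; ring.
apply: ler_wpM2l; first by apply: mulr_ge0 => //; exact: ltW.
by rewrite ler_pM ?mulr_ge0 ?exprn_ge0 ?cabs_ge0 ?invr_ge0 ?cabs_ge0.
Qed.

Lemma sum_geometric_le (x : R) n : 0 <= x < 1 ->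
  \sum_(j < n) x ^+ j <= (1 - x)^-1.
Proof.
move=> /andP[x0 x1]; rewrite -[leRHS]div1r ler_pdivlMr ?subr_gt0// mulrC.
by rewrite -opprB mulNr -subrX1 opprB gerBl exprn_ge0.
Qed.

(** Keeping n terms of the geometric series leaves a remainder O(r^(-n)), and
r^n >= n (r - 1) >= (r - 1) sqrt n. *)
Lemma sum_fluctuation_le (r : R) : 1 < r ->
  exists2 K : R, 0 < K & forall theta n t z k, (0 < n)%N -> r <= cabs z ->
    (forall m, (m < n)%N -> cabs (\sum_(k <= i < n) harmonic alpha c theta n m.+1 i) <= t) ->
  cabs (\sum_(k <= i < n) fluctuation alpha c theta n z i) <= K * (t + (Num.sqrt n%:R)^-1).
Proof.
move=> r1; have r0 : 0 < r by rewrite (lt_trans ltr01).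
have [rho rhoE] : {rho | rho = (1 - r^-1)^-1} by eexists.
have ri1 : 0 < 1 - r^-1 by rewrite subr_gt0 invf_lt1.
have rho0 : 0 < rho by rewrite rhoE invr_gt0.
have r10 : 0 < r - 1 by rewrite subr_gt0.
have [C CE] : {C | C = 2 * expR c * rho / (r - 1)} by eexists.
have C0 : 0 < C by rewrite CE divr_gt0// !mulr_gt0// expR_gt0.
exists (rho + C); first exact: addr_gt0.
move=> theta n t z k n0 rz hB.
have z1 : 1 < cabs z by rewrite (lt_le_trans r1).
have z0 : 0 < cabs z by rewrite (lt_trans ltr01).
have zr : (cabs z)^-1 <= r^-1 by rewrite lef_pV2 ?posrE.
have zi0 : 0 <= (cabs z)^-1 by rewrite invr_ge0 cabs_ge0.
have zi1 : (cabs z)^-1 < 1 by rewrite invf_lt1.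
have zrho : (1 - (cabs z)^-1)^-1 <= rho.
  have zi1' : 0 < 1 - (cabs z)^-1 by rewrite subr_gt0.
  by rewrite rhoE lef_pV2 ?posrE// lerB.
have t0 : 0 <= t by rewrite (le_trans _ (hB 0%N n0))// cabs_ge0.
pose rem i := xget 0 [set w | fluctuation alpha c theta n z i =
      \sum_(j < n) (z^-1) ^+ j * harmonic alpha c theta n j.+1 i + w /\
    cabs w <= 2 * a i * expR (- S n i.+1) * (cabs z)^-1 ^+ n / (1 - (cabs z)^-1)].
have hrem i : fluctuation alpha c theta n z i =
      \sum_(j < n) (z^-1) ^+ j * harmonic alpha c theta n j.+1 i + rem i /\
    cabs (rem i) <= 2 * a i * expR (- S n i.+1) * (cabs z)^-1 ^+ n / (1 - (cabs z)^-1).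
  rewrite /rem; case: xgetP => [w _ //|h].
  by have [w h1 h2] := fluctuation_expansion theta n i n z1; have := h w; case.
have -> : \sum_(k <= i < n) fluctuation alpha c theta n z i =
   \sum_(j < n) (z^-1) ^+ j * (\sum_(k <= i < n) harmonic alpha c theta n j.+1 i)
   + \sum_(k <= i < n) rem i.
  under eq_bigr do rewrite (hrem _).1.
  rewrite big_split/=; congr (_ + _).
  rewrite exchange_big/=; apply: eq_bigr => j _.
  by rewrite mulr_sumr.
have ap i : 0 <= a i := ltW (capacity_gt0 alpha_gt0 c_gt0 i).
have h1 : cabs (\sum_(j < n) (z^-1) ^+ j * (\sum_(k <= i < n) harmonic alpha c theta n j.+1 i))
   <= rho * t.
  rewrite (le_trans (cabs_sum _ _ _))//.
  apply: (@le_trans _ _ (\sum_(j < n) (cabs z)^-1 ^+ j * t)).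
    apply: ler_sum => j _; rewrite cabsM cabsX cabsV ler_wpM2l ?exprn_ge0//.
    exact: hB.
  rewrite -mulr_suml ler_wpM2r// (le_trans _ zrho)// sum_geometric_le// zi0.
  exact: zi1.
have h2 : cabs (\sum_(k <= i < n) rem i) <= C / Num.sqrt n%:R.
  rewrite (le_trans (cabs_sum _ _ _))//.
  apply: (@le_trans _ _ (\sum_(k <= i < n) (expR (- S n i.+1) * a i) * (2 * (r^-1 ^+ n * rho)))).
    apply: ler_sum => i _; rewrite (le_trans (hrem i).2)//.
    have -> : forall E x y : R, 2 * a i * E * x / y = E * a i * (2 * (x * y^-1)).
      by move=> *; ring.
    apply: ler_wpM2l; first exact: mulr_ge0 (expR_ge0 _) (ap i).
    apply: ler_wpM2l => //; apply: ler_pM => //.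
    - exact: exprn_ge0.
    - by rewrite invr_ge0 subr_ge0 ltW.
    by rewrite lerXn2r ?nnegrE ?invr_ge0 ?cabs_ge0 ?(ltW r0).
  rewrite -mulr_suml.
  have hs : \sum_(k <= i < n) expR (- S n i.+1) * a i <= expR c.
    rewrite (le_trans (sum_tail_le _ _ _)) ?sum_capacity_tail_le// => i.
    exact: mulr_ge0 (expR_ge0 _) (ap i).
  have hr : r^-1 ^+ n <= (r - 1)^-1 / Num.sqrt n%:R.
    rewrite -invfM exprVn lef_pV2 ?posrE ?exprn_gt0 ?mulr_gt0 ?sqrtr_gt0 ?ltr0n//.
    have b : (r - 1) * n%:R <= r ^+ n.
      elim: n {n0 t0 hB rem hrem h1 hs} => [|m IH]; first by rewrite mulr0 expr0.
      have hm : 1 <= r ^+ m by rewrite exprn_ege1// ltW.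
      by rewrite exprS -natr1; nra.
    rewrite (le_trans _ b)// ler_wpM2l ?(ltW r10)//.
    have n1 : 1 <= Num.sqrt n%:R :> R by rewrite -[leLHS]sqrtr1 ler_wsqrtr// ler1n.
    by rewrite -[leRHS](@sqr_sqrtr R)// expr2 ler_peMl// sqrtr_ge0.
  rewrite CE.
  have -> : 2 * expR c * rho / (r - 1) / Num.sqrt n%:R =
     expR c * (2 * ((r - 1)^-1 / Num.sqrt n%:R * rho)) by ring.
  rewrite ler_pM//.
  - by rewrite sumr_ge0// => i _; exact: mulr_ge0 (expR_ge0 _) (ap i).
  - by rewrite !mulr_ge0 ?exprn_ge0 ?invr_ge0 ?(ltW r0) ?(ltW rho0).
  by rewrite ler_wpM2l// ler_wpM2r// ltW.
apply: (le_trans (cabsD _ _)); apply: (le_trans (lerD h1 h2)).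
have sn0 : 0 <= (Num.sqrt n%:R)^-1 :> R by rewrite invr_ge0 sqrtr_ge0.
nra.
Qed.

End FourierExpansion.

(** * Products of independent variables *)

Section Independence.
Context {d : measure_display} {T : measurableType d} {R : realType}.
Variable P : probability T R.
Local Open Scope ereal_scope.

Import HBNNSimple.

Section Factorization.
Variables (X : {RV P >-> R}) (Y : T -> R).
Hypothesis (mY : measurable_fun setT Y) (Y0 : forall w, (0 <= Y w)%R).

Let EY := \int[P]_w (Y w)%:E.

Hypothesis YX : forall A : set R, measurable A ->
  \int[P]_w (Y w * \1_A (X w))%:E = EY * P (X @^-1` A).

(** Both sides are linear in f, and for an indicator function this is the
hypothesis on X and Y. *)
Lemma integral_mul_nnsfun (f : {nnsfun R >-> R}) :
  \int[P]_w (Y w * f (X w))%:E =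
  \sum_(y \in range f) y%:E * (EY * P (X @^-1` (f @^-1` [set y]))).
Proof.
have mX : measurable_fun setT X by [].
have mi y : measurable_fun setT (fun w => \1_(f @^-1` [set y]) (X w) : R).
  by apply: (measurableT_comp _ mX); exact: measurable_indic.
have yi0 y w : (0 <= y * \1_(f @^-1` [set y]) (X w) :> R)%R.
  by have := @nnfun_muleindic_ge0 _ _ _ f y (X w); rewrite lee_fin.
transitivity (\int[P]_w (\sum_(y \in range f)
    (Y w * (y * \1_(f @^-1` [set y]) (X w)))%:E)).
  apply: eq_integral => w _; rewrite fimfunE EFinM -fsumEFin//.
  by rewrite ge0_mule_fsumr// => y; rewrite lee_fin.
rewrite ge0_integral_fsum//; last 2 first.
  - move=> y; apply/measurable_EFinP; apply: measurable_funM => //.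
    by apply: measurable_funM.
  - by move=> y w _; rewrite lee_fin mulr_ge0.
apply: eq_fsbigr => y; rewrite inE => -[x _ fxy].
have y0 : (0 <= y)%R by rewrite -fxy.
rewrite -YX; last exact: measurable_sfunP.
rewrite -ge0_integralZl//.
- by apply: eq_integral => w _; rewrite -EFinM mulrCA.
- apply/measurable_EFinP; exact: measurable_funM.
- by move=> w _; rewrite lee_fin mulr_ge0// indicE.
Qed.

End Factorization.

(** Monotone approximation of g by simple functions.  The value of the integral of a
simple function of X alone is the case Y = 1 of [integral_mul_nnsfun]. *)
Lemma integral_mul_independent (X : {RV P >-> R}) (Y : T -> R) (g : R -> R) :
  measurable_fun setT Y -> (forall w, (0 <= Y w)%R) ->
  \int[P]_w (Y w)%:E \is a fin_num ->
  (forall A : set R, measurable A ->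
    \int[P]_w (Y w * \1_A (X w))%:E = (\int[P]_w (Y w)%:E) * P (X @^-1` A)) ->
  measurable_fun setT g -> (forall x, (0 <= g x)%R) ->
  \int[P]_w (Y w * g (X w))%:E = (\int[P]_w (Y w)%:E) * \int[P]_w (g (X w))%:E.
Proof.
move=> mY Y0 fY YX mg g0.
have mX : measurable_fun setT X by [].
have mg' : measurable_fun setT (EFin \o g) by exact/measurable_EFinP.
have g0' x : setT x -> 0 <= (EFin \o g) x by move=> _; rewrite lee_fin.
pose f_ := nnsfun_approx measurableT mg'.
have fnd w m n : (m <= n)%N -> (f_ m w <= f_ n w)%R.
  by move=> mn; exact/lefP/nd_nnsfun_approx.
have EY0 : 0 <= \int[P]_w (Y w)%:E by apply: integral_ge0 => w _; rewrite lee_fin.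
(* used with Z = Y for the left-hand side and with Z = 1 for the right-hand side *)
have lim_f (Z : T -> R) : measurable_fun setT Z -> (forall w, (0 <= Z w)%R) ->
    \int[P]_w (Z w * g (X w))%:E =
    limn (fun n => \int[P]_w (Z w * f_ n (X w))%:E) /\
    cvgn (fun n => \int[P]_w (Z w * f_ n (X w))%:E).
  move=> mZ Z0.
  have mfn n : measurable_fun setT (fun w => (Z w * f_ n (X w))%:E).
    apply/measurable_EFinP; apply: measurable_funM => //.
    exact: (measurableT_comp (measurable_funTS _) mX).
  split.
    rewrite -monotone_convergence//.
    - apply: eq_integral => w _; apply/esym/cvg_lim => //.
      under eq_fun do rewrite EFinM.
      rewrite EFinM; apply: cvgeZl => //.
      exact: cvg_nnsfun_approx.
    - by move=> n w _; rewrite lee_fin mulr_ge0.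
    - by move=> w _ m n mn; rewrite lee_fin ler_wpM2l// fnd.
  apply: ereal_nondecreasing_is_cvgn => m n mn; apply: ge0_le_integral => //.
  - by move=> w _; rewrite lee_fin mulr_ge0.
  - by move=> w _; rewrite lee_fin ler_wpM2l// fnd.
have [-> _] := lim_f Y mY Y0.
have [|//|] := lim_f (cst 1%R); first exact: measurable_cst.
under eq_integral do rewrite mul1r.
move=> -> cv1; rewrite -limeMl//.
apply: congr_lim; apply/funext => n /=.
have E1 : \int[P]_w (cst 1%R w)%:E = 1.
  by rewrite /= integral_cst// mul1e; exact: probability_setT.
rewrite (integral_mul_nnsfun mY Y0 YX).
rewrite (@integral_mul_nnsfun X (cst 1%R))//; last first.
  move=> A mA; rewrite E1 mul1e.
  under eq_integral do rewrite mul1r.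
  rewrite -[X in _ = P X]setIT -(integral_indic P measurableT)//.
  by rewrite -[X in measurable X]setTI; exact: mX.
rewrite ge0_mule_fsumr//.
  apply: eq_fsbigr => y _; rewrite E1 mul1e.
  by rewrite muleCA.
move=> y; rewrite E1 mul1e.
have [y0|y0] := leP 0%R y; first by rewrite mule_ge0// lee_fin.
rewrite (_ : f_ n @^-1` [set y] = set0) ?preimage_set0 ?measure0 ?mule0//.
rewrite -subset0 => x /= fxy.
by have : (0 <= f_ n x)%R by []; rewrite fxy leNgt y0.
Qed.

Variable theta : nat -> {RV P >-> R}.
Hypothesis indep : mutually_independent theta.

(** Induction on l.  The indicator factors carry the induction: to peel off g j one
needs the factorization with g j replaced by the indicator of an arbitrary set,
which is the induction hypothesis with j moved from l to l2. *)
Lemma integral_prod_indic (l l2 : seq nat) (g : nat -> R -> R) (A : nat -> set R) :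
  uniq (l ++ l2) ->
  (forall i, measurable_fun setT (g i)) -> (forall i x, (0 <= g i x)%R) ->
  (forall i, \int[P]_w (g i (theta i w))%:E \is a fin_num) ->
  (forall i, measurable (A i)) ->
  \int[P]_w ((\prod_(i <- l) g i (theta i w)) *
             (\prod_(i <- l2) \1_(A i) (theta i w)))%:E =
  (\prod_(i <- l) \int[P]_w (g i (theta i w))%:E) *
  (\prod_(i <- l2) P (theta i @^-1` A i)).
Proof.
move=> + mg g0 fg; elim: l l2 A => [|j l IH] l2 A ul mA.
  under eq_integral do rewrite big_nil mul1r.
  rewrite big_nil mul1e -indep//.
  rewrite -[X in _ = P X]setIT -(integral_indic P measurableT); last first.
    rewrite bigcap_seq; apply: bigsetI_measurable => i _.
    by rewrite -[X in measurable X]setTI; exact: (measurable_funP (theta i)).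
  apply: eq_integral => w _; congr EFin.
  elim: l2 {ul} => [|k l2 IH].
    by rewrite big_nil set_nil bigcap_set0 indicT.
  rewrite big_cons IH !indicE -natrM mulnb; congr (_%:R); apply: congr1.
  apply/andP/idP => [[/set_mem Ak /set_mem Al]|/set_mem h].
    apply/mem_set => i /=; rewrite inE => /predU1P[->//|il]; exact: Al.
  split; apply/mem_set; first by apply: h; rewrite /= inE eqxx.
  by move=> i il; apply: h; move: il; rewrite /= inE => ->; rewrite orbT.
rewrite big_cons.
have jl2 : j \notin l /\ j \notin l2.
  by move: ul; rewrite /= mem_cat negb_or => /andP[/andP[]].
have ul' : uniq (l ++ l2) by case/andP: ul.
have mprod (l3 : seq nat) (h : nat -> R -> R) : (forall i, measurable_fun setT (h i)) ->
    measurable_fun setT (fun w => \prod_(i <- l3) h i (theta i w))%R.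
  move=> mh; apply: measurable_prod => i _.
  exact: (measurableT_comp (mh i) (measurable_funP (theta i))).
have mi (B : nat -> set R) : (forall i, measurable (B i)) ->
    forall i, measurable_fun setT (\1_(B i) : R -> R).
  by move=> mB i; exact: measurable_indic.
pose Y w := ((\prod_(i <- l) g i (theta i w)) *
             (\prod_(i <- l2) \1_(A i) (theta i w)))%R.
have mY : measurable_fun setT Y.
  apply: measurable_funM; first exact: mprod.
  exact: (mprod l2 (fun i => \1_(A i)) (mi A mA)).
have Y0 w : (0 <= Y w)%R.
  by rewrite mulr_ge0// prodr_ge0// => i _; rewrite indicE.
have fY : \int[P]_w (Y w)%:E \is a fin_num.
  rewrite /Y IH// fin_numM//; first by apply: prode_fin_num => i _.
  apply: prode_fin_num => i _; apply: fin_num_measure.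
  by rewrite -[X in measurable X]setTI; exact: (measurable_funP (theta i)).
have := @integral_mul_independent (theta j) Y (g j) mY Y0 fY.
move=> /(_ _ (mg j) (g0 j)) => h.
transitivity (\int[P]_w (Y w * g j (theta j w))%:E).
  by apply: eq_integral => w _; rewrite big_cons /Y; congr EFin; ring.
rewrite h; first by rewrite /Y IH// muleC muleA.
move=> B mB; rewrite /Y IH//.
pose A' i := if i == j then B else A i.
have A'j : A' j = B by rewrite /A' eqxx.
have mA' i : measurable (A' i) by rewrite /A'; case: ifP.
have A'l2 (I : Type) (idx : I) op (F : nat -> set R -> I) :
    \big[op/idx]_(i <- l2) F i (A' i) = \big[op/idx]_(i <- l2) F i (A i).
  rewrite big_seq [RHS]big_seq; apply: eq_bigr => i il2; rewrite /A' ifN//.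
  by apply: contraTneq il2 => ->; case: jl2.
have := IH (j :: l2) A'.
rewrite !big_cons (A'l2 _ 1 _ (fun i X => P (theta i @^-1` X))).
rewrite A'j => h'.
rewrite -muleA [X in _ * X]muleC -h'//.
- apply: eq_integral => w _; rewrite big_cons A'j.
  rewrite (A'l2 _ 1%R _ (fun i X => \1_X (theta i w))); congr EFin; ring.
- by rewrite -cat1s uniq_catCA.
Qed.

Lemma integral_prod (l : seq nat) (g : nat -> R -> R) : uniq l ->
  (forall i, measurable_fun setT (g i)) -> (forall i x, (0 <= g i x)%R) ->
  (forall i, \int[P]_w (g i (theta i w))%:E \is a fin_num) ->
  \int[P]_w (\prod_(i <- l) g i (theta i w))%:E =
  \prod_(i <- l) \int[P]_w (g i (theta i w))%:E.
Proof.
move=> ul mg g0 fg.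
have := @integral_prod_indic l [::] g (fun=> set0).
rewrite cats0 big_nil mule1 => <-//.
by apply: eq_integral => w _; rewrite big_nil mulr1.
Qed.

End Independence.

(** * A Hoeffding inequality *)

Section Hoeffding.
Context {R : realType}.

(** For x <= 1/4 through exp(x) <= (1 - x/2)^(-2) <= 1 + x + x^2; beyond that,
x <= 4 x^2. *)
Lemma expR_le_quad (x : R) : expR x <= x + expR (4 * x ^+ 2).
Proof.
have [x4|x4] := leP x (1 / 4); last first.
  rewrite (@le_trans _ _ (expR (4 * x ^+ 2)))// ?ler_expR; first by nra.
  by rewrite lerDr; lra.
have h1 := expR_ge1Dx (- (x / 2)).
have h0 : 0 < 1 - x / 2 by lra.
have h2 : expR (x / 2) <= (1 - x / 2)^-1.
  by rewrite -[X in expR X]opprK expRN lef_pV2 ?posrE ?expR_gt0.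
have h3 : expR x <= (1 - x / 2) ^- 2.
  have -> : expR x = expR (x / 2) ^+ 2 by rewrite -expRM_natl; congr expR; field.
  by rewrite -exprVn lerXn2r ?nnegrE ?expR_ge0 ?invr_ge0 ?(ltW h0).
have h4 : (1 - x / 2) ^- 2 <= 1 + x + x ^+ 2.
  rewrite -div1r ler_pdivrMr ?exprn_gt0//.
  have : 0 <= x ^+ 2 * (1 - 3 * x + x ^+ 2) by rewrite mulr_ge0 ?sqr_ge0//; nra.
  nra.
have h5 := expR_ge1Dx (4 * x ^+ 2).
have := sqr_ge0 x; lra.
Qed.

Section Tail.
Context {d : measure_display} {T : measurableType d}.
Variable (P : probability T R) (theta : nat -> {RV P >-> R}) (g : R -> R).
Hypothesis (indep : mutually_independent theta).
Hypothesis (mg : measurable_fun setT g) (g1 : forall x, `|g x| <= 1).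
Hypothesis gmean : forall i, (\int[P]_w (1 - g (theta i w))%:E = 1)%E.

Lemma integral_probability_cst (k : R) : (\int[P]_w k%:E = k%:E)%E.
Proof.
rewrite -[RHS]mule1 (integral_cst P measurableT k%:E); congr (_ * _)%E.
exact: probability_setT.
Qed.

(** Integrate exp(v g) <= v g + exp(4 v^2).  Adding v (1 - g) to both sides keeps all
integrands nonnegative, and gives the mean of g through [gmean]. *)
Lemma mgf_le (v : R) i : 0 <= v ->
  (\int[P]_w (expR (v * g (theta i w)))%:E <= (expR (4 * v ^+ 2))%:E)%E.
Proof.
move=> v0; have mgt : measurable_fun setT (fun w => g (theta i w)).
  exact: (measurableT_comp mg (measurable_funP (theta i))).
have m1 : measurable_fun setT (fun w => (expR (v * g (theta i w)))%:E).
  apply/measurable_EFinP; apply: (measurableT_comp (@measurable_expR R)).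
  exact: measurable_funM.
have m2 : measurable_fun setT (fun w => (1 - g (theta i w))%:E).
  by apply/measurable_EFinP; apply: measurable_funB.
have g11 w : 0 <= 1 - g (theta i w).
  by rewrite subr_ge0 (le_trans (ler_norm _)).
have m3 : measurable_fun setT (fun w => (v%:E * (1 - g (theta i w))%:E)%E).
  by apply: emeasurable_funM => //; exact: measurable_cst.
have h : (\int[P]_w ((expR (v * g (theta i w)))%:E + v%:E * (1 - g (theta i w))%:E)
    <= \int[P]_w (expR (4 * v ^+ 2) + v)%:E)%E.
  apply: ge0_le_integral => //.
  - by move=> w _; rewrite adde_ge0// ?mule_ge0// lee_fin ?expR_ge0.
  - exact: emeasurable_funD.
  - move=> w _; rewrite -EFinM -EFinD lee_fin.
    have h1 := expR_le_quad (v * g (theta i w)).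
    have h2 : expR (4 * (v * g (theta i w)) ^+ 2) <= expR (4 * v ^+ 2).
      rewrite ler_expR ler_wpM2l// exprMn ler_piMr ?sqr_ge0//.
      by rewrite -(real_normK (num_real _)) exprn_ile1.
    lra.
rewrite integral_probability_cst EFinD in h.
have e0 w : [set: T] w -> (0 <= (expR (v * g (theta i w)))%:E)%E.
  by move=> _; rewrite lee_fin expR_ge0.
have e1 w : [set: T] w -> (0 <= v%:E * (1 - g (theta i w))%:E)%E.
  by move=> _; rewrite mule_ge0// lee_fin.
have e2 w : [set: T] w -> (0 <= (1 - g (theta i w))%:E)%E.
  by move=> _; rewrite lee_fin.
have v0' : (0 <= v%:E)%E by rewrite lee_fin.
rewrite (ge0_integralD P measurableT e0 m1 e1 m3) in h.
rewrite (ge0_integralZl P measurableT m2 e2 v0') gmean mule1 in h.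
by move: h; rewrite leeD2rE.
Qed.

(** Exponential Markov inequality; the exponential of the sum is a product of
independent factors. *)
Lemma hoeffding_tail (s : seq nat) (u : nat -> R) (V t : R) : uniq s ->
  (forall i, 0 <= u i) -> 0 < V -> 0 <= t -> \sum_(i <- s) u i ^+ 2 <= V ->
  measurable [set w | t < \sum_(i <- s) u i * g (theta i w)] /\
  (P [set w | (t < \sum_(i <- s) u i * g (theta i w))%R] <=
    (expR (- (t ^+ 2 / (16 * V))))%:E)%E.
Proof.
move=> us u0 V0 t0 sV.
have mS : measurable_fun setT (fun w => \sum_(i <- s) u i * g (theta i w)).
  apply: measurable_sum => i; apply: measurable_funM => //.
  exact: (measurableT_comp mg (measurable_funP (theta i))).
set A := [set w | _].
have mA : measurable A.
  rewrite (_ : A = (fun w => \sum_(i <- s) u i * g (theta i w)) @^-1` `]t, +oo[).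
    by rewrite -[X in measurable X]setTI; exact: mS.
  by apply/seteqP; split => w /=; rewrite in_itv/= andbT.
split=> //.
(* the minimizer of 4 V x^2 - x t *)
have [x xE] : {x | x = t / (8 * V)} by eexists.
have x0 : 0 <= x by rewrite xE divr_ge0// mulr_ge0// ltW.
have step : ((expR (x * t))%:E * P A <=
    \int[P]_w (\prod_(i <- s) expR (x * u i * g (theta i w)))%:E)%E.
  have mprod : measurable_fun setT
      (fun w => (\prod_(i <- s) expR (x * u i * g (theta i w)))%:E).
    apply/measurable_EFinP; apply: measurable_prod => i _.
    apply: (measurableT_comp (@measurable_expR R)); apply: measurable_funM => //.
    exact: (measurableT_comp mg (measurable_funP (theta i))).
  rewrite -[A]setIT -(integral_indic P measurableT)// -ge0_integralZl//; last first.
    by apply/measurable_EFinP; exact: measurable_indic.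
  apply: ge0_le_integral => //.
  - apply: emeasurable_funM; first exact: measurable_cst.
    by apply/measurable_EFinP; exact: measurable_indic.
  - move=> w _; rewrite -EFinM lee_fin indicE.
    have [/set_mem wA|_] := boolP (w \in A); last first.
      by rewrite mulr0 prodr_ge0// => i _; rewrite expR_ge0.
    rewrite mulr1 -expR_sum ler_expR.
    under eq_bigr do rewrite -mulrA.
    by rewrite -mulr_sumr ler_wpM2l// ltW.
have xu0 i : 0 <= x * u i by rewrite mulr_ge0.
rewrite (@integral_prod _ _ _ _ _ indep s (fun i y => expR (x * u i * g y)) us) in step; last 3 first.
- move=> i; apply: (measurableT_comp (@measurable_expR R)).
  by apply: measurable_funM.
- by move=> i y; rewrite expR_ge0.
- move=> i; rewrite ge0_fin_numE; last first.
    by apply: integral_ge0 => w _; rewrite lee_fin expR_ge0.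
  by rewrite (le_lt_trans (mgf_le i (xu0 i)))// ltry.
have hprod : (\prod_(i <- s) \int[P]_w (expR (x * u i * g (theta i w)))%:E
    <= (expR (4 * x ^+ 2 * V))%:E)%E.
  apply: (@le_trans _ _ (\prod_(i <- s) (expR (4 * (x * u i) ^+ 2))%:E)%E).
    elim: (s) => [|i s' IH]; first by rewrite !big_nil.
    rewrite !big_cons; apply: lee_pmul => //; last exact: mgf_le.
    - by apply: integral_ge0 => w _; rewrite lee_fin expR_ge0.
    - by apply: prode_ge0 => k _; apply: integral_ge0 => w _; rewrite lee_fin expR_ge0.
  rewrite prodEFin -expR_sum lee_fin ler_expR.
  under eq_bigr do rewrite exprMn mulrA.
  by rewrite -mulr_sumr ler_wpM2l// mulr_ge0// sqr_ge0.
have := le_trans step hprod.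
rewrite -(fineK (fin_num_measure P _ mA)) -EFinM !lee_fin => h.
rewrite mulrC -ler_pdivlMr ?expR_gt0// -expRB in h.
rewrite (le_trans h)// ler_expR le_eqVlt; apply/orP; left; apply/eqP.
by rewrite xE; field; rewrite gt_eqF.
Qed.

End Tail.

End Hoeffding.

Section UniformAngle.
Context {d : measure_display} {T : measurableType d} {R : realType}.
Variable P : probability T R.

(** A function with a periodic primitive G has mean zero over the circle. *)
Lemma integral_uniform_angle (X : {RV P >-> R}) (g G : R -> R) :
  uniform_angle X -> continuous g -> (forall x, `|g x| <= 1) ->
  (forall x : R, is_derive x 1 G (g x)) -> G (2 * pi) = G 0 ->
  (\int[P]_w (1 - g (X w))%:E = 1)%E.
Proof.
move=> uX cg g1 dG GE.
have mg : measurable_fun setT (fun x => (1 - g x)%:E).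
  apply/measurable_EFinP; apply: measurable_funB => //.
  exact: continuous_measurable_fun.
have g0 x : (0 <= (1 - g x)%:E)%E by rewrite lee_fin subr_ge0 (le_trans (ler_norm _)).
have pi2 : 0 < 2 * pi :> R := mulr_gt0 (ltr0Sn R 1) (pi_gt0 R).
(* the uniform law lives on the Borel structure measurableTypeR, which has the
   same sets as the one carried by R but is a different structure *)
have mX : measurable_fun setT (X : T -> measurableTypeR R).
  have mX0 : measurable_fun setT X by [].
  by move=> mT B mB; exact: (mX0 mT B mB).
have mg' : measurable_fun setT ((fun x => (1 - g x)%:E) : measurableTypeR R -> \bar R).
  by move=> mT B mB; exact: (mg mT B mB).
have := @ge0_integral_pushforward _ _ T (measurableTypeR R) R _ mX P setT
  (fun x => (1 - g x)%:E) measurableT mg' (fun x _ => g0 x).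
rewrite preimage_setT => <-.
rewrite (@eq_measure_integral _ (measurableTypeR R) R setT
  (uniform_prob (mulr_gt0 (ltr0Sn R 1) (pi_gt0 R)))); last first.
  by move=> A mA _; exact: uX.
rewrite integral_uniform//.
rewrite (@continuous_FTC2 _ (fun x => 1 - g x) (fun x => x - G x) 0 (2 * pi) pi2).
- rewrite GE sub0r -EFinB opprK subrK subr0 -EFinM mulVf// gt_eqF//.
- apply: continuous_subspaceT => x; apply: cvgB; [exact: cvg_cst|exact: cg].
- have dF x : derivable (fun x => x - G x) x 1 by [].
  have cF x : {for x, continuous (fun x => x - G x)}.
    by apply: differentiable_continuous; apply/derivable1_diffP.
  split => //.
  + by apply: cvg_at_right_filter; exact: cF.
  + by apply: cvg_at_left_filter; exact: cF.
- move=> x _; rewrite derive1E.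
  have hd : is_derive x 1 (fun x => x - G x) (1 - g x) by apply: is_deriveB.
  by rewrite derive_val.
Qed.

End UniformAngle.

(** * Concentration of the harmonics *)

Section HarmonicTail.
Context {d : measure_display} {T : measurableType d} {R : realType}.
Variable P : probability T R.

Lemma measure_bigsetU_le (A : nat -> set T) (n : nat) (p : R) :
  (forall i, (i < n)%N -> measurable (A i) /\ (P (A i) <= p%:E)%E) ->
  measurable (\big[setU/set0]_(i < n) A i) /\
  (P (\big[setU/set0]_(i < n) A i) <= (n%:R * p)%:E)%E.
Proof.
move=> h; split; first by apply: bigsetU_measurable => i _; exact: (h i (ltn_ord i)).1.
apply: (le_trans (Boole_inequality P _)); first by move=> i /h[].
apply: (@le_trans _ _ (\sum_(i < n) p%:E)%E).
  by apply: lee_sum => i _; exact: (h i (ltn_ord i)).2.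
by rewrite sumEFin lee_fin sumr_const card_ord mulr_natl.
Qed.

Lemma mean_cos (X : {RV P >-> R}) (m : nat) (s : R) : uniform_angle X -> `|s| <= 1 ->
  (\int[P]_w (1 - s * cos (m.+1%:R * X w))%:E = 1)%E.
Proof.
move=> uX s1.
have m0 : m.+1%:R != 0 :> R by rewrite pnatr_eq0.
apply: (@integral_uniform_angle _ _ _ _ _ (fun x => s * cos (m.+1%:R * x))
  (fun x => s * (sin (m.+1%:R * x) / m.+1%:R)) uX).
- move=> x; apply: cvgM; first exact: cvg_cst.
  apply: continuous_cvg; first exact: continuous_cos.
  by apply: cvgM; [exact: cvg_cst|exact: cvg_id].
- by move=> x; rewrite normrM mulr_ile1 ?cos_max.
- move=> x; apply: is_derive_eq.
  by rewrite /GRing.scale/=; field.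
- have -> : m.+1%:R * (2 * pi) = 0 + pi *+ 2 *+ m.+1 :> R.
    by rewrite add0r !mulr_natl.
  by rewrite (periodicn (@sinD2pi R)) mulr0.
Qed.

Lemma mean_sin (X : {RV P >-> R}) (m : nat) (s : R) : uniform_angle X -> `|s| <= 1 ->
  (\int[P]_w (1 - s * sin (m.+1%:R * X w))%:E = 1)%E.
Proof.
move=> uX s1.
have m0 : m.+1%:R != 0 :> R by rewrite pnatr_eq0.
apply: (@integral_uniform_angle _ _ _ _ _ (fun x => s * sin (m.+1%:R * x))
  (fun x => s * (- (cos (m.+1%:R * x) / m.+1%:R))) uX).
- move=> x; apply: cvgM; first exact: cvg_cst.
  apply: continuous_cvg; first exact: continuous_sin.
  by apply: cvgM; [exact: cvg_cst|exact: cvg_id].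
- by move=> x; rewrite normrM mulr_ile1 ?sin_max.
- move=> x; apply: is_derive_eq.
  by rewrite /GRing.scale/=; field.
- have -> : m.+1%:R * (2 * pi) = 0 + pi *+ 2 *+ m.+1 :> R.
    by rewrite add0r !mulr_natl.
  by rewrite (periodicn (@cosD2pi R)) mulr0.
Qed.

Variables (alpha c : R) (theta : nat -> {RV P >-> R}).
Hypothesis (alpha_gt0 : 0 < alpha) (alpha_lt2 : alpha < 2) (c_gt0 : 0 < c).
Hypothesis (indep : mutually_independent theta) (unif : forall n, uniform_angle (theta n)).

Local Notation a := (capacity alpha c).
Local Notation S := (tail_capacity alpha c).

(** The four functions whose upper tails control the modulus of a harmonic: the
real and imaginary parts and their opposites. *)
Definition trig (b : nat) (x : R) : R :=
  nth 0 [:: cos x; - cos x; sin x; - sin x] b.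

Definition amplitude (n m i : nat) : R := 2 * a i * expR (- S n i.+1) ^+ m.

Definition harmonic_event (n : nat) (t : R) (m k b : nat) : set T :=
  [set w | t < \sum_(i <- index_iota k n) amplitude n m.+1 i * trig b (m.+1%:R * theta i w)].

Definition bad_event (n : nat) (t : R) : set T :=
  \big[setU/set0]_(m < n) \big[setU/set0]_(k < n) \big[setU/set0]_(b < 4)
    harmonic_event n t m k b.

(** The factor exp(- S n (i+1)) is at most 1, so the amplitude of every harmonic is
bounded by that of the first one and the same variance bound serves for all m. *)
Lemma harmonic_event_tail (V t : R) n m k b : (b < 4)%N -> 0 < V -> 0 <= t ->
  \sum_(0 <= i < n) (expR (- S n i.+1) * a i) ^+ 2 <= V ->
  measurable (harmonic_event n t m k b) /\
  (P (harmonic_event n t m k b) <= (expR (- (t ^+ 2 / (64 * V))))%:E)%E.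
Proof.
move=> b4 V0 t0 hV.
have ap i : 0 <= a i := ltW (capacity_gt0 alpha_gt0 c_gt0 i).
have -> : 64 * V = 16 * (4 * V) by ring.
have mlin : measurable_fun [set: R] (fun x : R => m.+1%:R * x) by exact: measurable_funM.
have mc : measurable_fun setT (fun x : R => cos (m.+1%:R * x)).
  apply: (measurableT_comp _ mlin).
  by apply: continuous_measurable_fun; exact: continuous_cos.
have ms : measurable_fun setT (fun x : R => sin (m.+1%:R * x)).
  apply: (measurableT_comp _ mlin).
  by apply: continuous_measurable_fun; exact: continuous_sin.
apply: (@hoeffding_tail _ _ _ P theta (fun x => trig b (m.+1%:R * x))) => //.
- case: b b4 => [|[|[|[|//]]]] _; rewrite /trig/= => //.
    exact: measurable_funN.
  exact: measurable_funN.
- move=> x; case: b b4 => [|[|[|[|//]]]] _; rewrite /trig/= ?normrN ?cos_max ?sin_max//.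
- move=> i; case: b b4 => [|[|[|[|//]]]] _; rewrite /trig/=.
  + have := @mean_cos (theta i) m 1 (unif i); rewrite normr1 => /(_ (lexx _)) <-.
    by apply: eq_integral => w _; rewrite mul1r.
  + have := @mean_cos (theta i) m (-1) (unif i); rewrite normrN1 => /(_ (lexx _)) <-.
    by apply: eq_integral => w _; rewrite mulN1r.
  + have := @mean_sin (theta i) m 1 (unif i); rewrite normr1 => /(_ (lexx _)) <-.
    by apply: eq_integral => w _; rewrite mul1r.
  + have := @mean_sin (theta i) m (-1) (unif i); rewrite normrN1 => /(_ (lexx _)) <-.
    by apply: eq_integral => w _; rewrite mulN1r.
- exact: iota_uniq.
- move=> i; apply: mulr_ge0; last by rewrite exprn_ge0// expR_ge0.
  exact: mulr_ge0.
- exact: mulr_gt0.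
- apply: (@le_trans _ _ (\sum_(k <= i < n) 4 * (expR (- S n i.+1) * a i) ^+ 2)).
    apply: ler_sum => i _.
    have E0 : 0 <= expR (- S n i.+1) := expR_ge0 _.
    have E1 : expR (- S n i.+1) <= 1 by rewrite expR_le1 oppr_le0 tail_capacity_ge0.
    have -> : 4 * (expR (- S n i.+1) * a i) ^+ 2 = (2 * a i * expR (- S n i.+1)) ^+ 2 by ring.
    have h0 : 0 <= 2 * a i by apply: mulr_ge0.
    rewrite lerXn2r ?nnegrE//.
    + by apply: mulr_ge0 => //; rewrite exprn_ge0.
    + exact: mulr_ge0.
    + by rewrite ler_wpM2l// exprS ler_piMr// exprn_ile1.
  rewrite -mulr_sumr ler_wpM2l// (le_trans _ hV)// sum_tail_le// => i.
  exact: sqr_ge0.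
Qed.

Lemma bad_event_tail (V t : R) n : 0 < V -> 0 <= t ->
  \sum_(0 <= i < n) (expR (- S n i.+1) * a i) ^+ 2 <= V ->
  measurable (bad_event n t) /\
  (P (bad_event n t) <= (n%:R * (n%:R * (4 * expR (- (t ^+ 2 / (64 * V))))))%:E)%E.
Proof.
move=> V0 t0 hV; apply: (@measure_bigsetU_le (fun m => \big[setU/set0]_(k < n)
  \big[setU/set0]_(b < 4) harmonic_event n t m k b)) => m _.
apply: (@measure_bigsetU_le (fun k =>
  \big[setU/set0]_(b < 4) harmonic_event n t m k b)) => k _.
apply: (@measure_bigsetU_le (fun b => harmonic_event n t m k b)) => b b4.
exact: harmonic_event_tail.
Qed.

Lemma not_bad_event (t : R) n w : 0 <= t -> ~ bad_event n t w ->
  forall k m, (m < n)%N ->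
    cabs (\sum_(k <= i < n) harmonic alpha c (fun i => theta i w) n m.+1 i) <= 2 * t.
Proof.
move=> t0 hw k m mn.
have [nk|kn] := leqP n k; first by rewrite big_geq// cabs0 mulr_ge0.
have h b : (b < 4)%N ->
    \sum_(k <= i < n) amplitude n m.+1 i * trig b (m.+1%:R * theta i w) <= t.
  move=> b4; rewrite leNgt; apply/negP => hb; apply: hw.
  rewrite /bad_event -(bigcup_mkord n (fun m => \big[setU/set0]_(k < n)
    \big[setU/set0]_(b < 4) harmonic_event n t m k b)); exists m => //.
  rewrite -(bigcup_mkord n (fun k =>
    \big[setU/set0]_(b < 4) harmonic_event n t m k b)); exists k => //.
  by rewrite -(bigcup_mkord 4 (harmonic_event n t m k)); exists b.
have hE i : harmonic alpha c (fun i => theta i w) n m.+1 i =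
   Complex (amplitude n m.+1 i * cos (m.+1%:R * theta i w))
           (amplitude n m.+1 i * sin (m.+1%:R * theta i w)).
  rewrite /harmonic cexp_rotX -/(amplitude n m.+1 i).
  by move: (amplitude n m.+1 i) => A; simpc.
have hS : \sum_(k <= i < n) harmonic alpha c (fun i => theta i w) n m.+1 i =
   Complex (\sum_(k <= i < n) amplitude n m.+1 i * cos (m.+1%:R * theta i w))
           (\sum_(k <= i < n) amplitude n m.+1 i * sin (m.+1%:R * theta i w)).
  elim/big_rec3 : _ => // i x y z _ ->; rewrite hE; simpc => //.
rewrite hS (le_trans (cabs_le_ReIm _))//=.
have -> : 2 * t = t + t by ring.
have hN (F G : nat -> R) : - (\sum_(k <= i < n) F i * G i) =
   \sum_(k <= i < n) F i * - G i.
  by rewrite -sumrN; apply: eq_bigr => i _; rewrite mulrN.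
rewrite lerD// ler_norml lerNl hN; apply/andP; split.
- exact: (h 1%N).
- exact: (h 0%N).
- exact: (h 3%N).
- exact: (h 2%N).
Qed.

End HarmonicTail.

(** * Measurability of the deviation events *)

Section ContinuityOutside.
Local Open Scope complex_scope.
Context {R : realType}.
Implicit Types (g h : R[i] -> R[i]) (z : R[i]).

(** Continuity of the restriction to the exterior disc.  The real-valued modulus
replaces the norm of R[i], whose values are complex. *)
Definition continuous_outside g := forall z, 1 < cabs z -> forall e : R, 0 < e ->
  exists2 dl : R, 0 < dl & forall z', 1 < cabs z' -> cabs (z' - z) < dl ->
    cabs (g z' - g z) < e.

Definition preserves_outside g := forall z, 1 < cabs z -> 1 < cabs (g z).

Lemma derivable_continuous_outside g :
  holomorphic_on (@exterior_disc R) g -> continuous_outside g.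
Proof.
move=> hg z z1 e e0.
have /derivable1_diffP/differentiable_continuous := hg z z1.
move=> /cvgrPdist_lt /(_ e%:C); rewrite ltcR => /(_ e0).
move=> /nbhs_normP[dl /= dl0 hdl].
have dlE : dl = (complex.Re dl)%:C by rewrite RRe_real// gtr0_real.
have dl0' : 0 < complex.Re dl by rewrite -ltcR -dlE.
exists (complex.Re dl) => // z' _ zz'.
rewrite cabsC -ltcR -cabsE; apply: hdl.
by rewrite /= dlE cabsE ltcR cabsC.
Qed.

Lemma continuous_outside_comp g h : continuous_outside g -> preserves_outside g ->
  continuous_outside h -> continuous_outside (h \o g).
Proof.
move=> cg pg ch z z1 e e0.
have [d1 d10 h1] := ch _ (pg _ z1) _ e0.
have [d2 d20 h2] := cg _ z1 _ d10.
by exists d2 => // z' z'1 /(h2 _ z'1); apply: h1; exact: pg.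
Qed.

Lemma continuous_outside_rotated g t : continuous_outside g ->
  continuous_outside (rotated g t).
Proof.
move=> cg z z1 e e0; rewrite /rotated.
have z1' : 1 < cabs (z * cexp (- t%:C * 'i)) by rewrite cabsM cabs_rotN mulr1.
have [dl dl0 hdl] := cg _ z1' _ e0.
exists dl => // z' z'1 zz'; rewrite -mulrBr cabsM cabs_rot mul1r; apply: hdl.
  by rewrite cabsM cabs_rotN mulr1.
by rewrite -mulrBl cabsM cabs_rotN mulr1.
Qed.

Lemma preserves_outside_rotated g t : preserves_outside g ->
  preserves_outside (rotated g t).
Proof.
move=> pg z z1; rewrite cabsM cabs_rot mul1r; apply: pg.
by rewrite cabsM cabs_rotN mulr1.
Qed.

Lemma ReB z z' : complex.Re (z - z') = complex.Re z - complex.Re z'.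
Proof. by case: z => a b; case: z'. Qed.

Lemma ImB z z' : complex.Im (z - z') = complex.Im z - complex.Im z'.
Proof. by case: z => a b; case: z'. Qed.

Lemma rational_approx (z : R[i]) (e : R) : 0 < e ->
  exists pq : rat * rat, cabs (z - (ratr pq.1 +i* ratr pq.2)) < e.
Proof.
case: z => x y e0.
have h u : exists q : rat, `|u - ratr q| < e / 2.
  have [|q] := @rat_in_itvoo R (u - e / 2) (u + e / 2).
    by rewrite ltrD2l gtrN// divr_gt0.
  rewrite in_itv/= => /andP[h1 h2]; exists q.
  by rewrite ltr_norml; apply/andP; split; lra.
have [p hp] := h x; have [q hq] := h y; exists (p, q).
rewrite (le_lt_trans (cabs_le_ReIm _))//=.
by rewrite [ltRHS](splitr e) ltrD.
Qed.

End ContinuityOutside.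

Section ComplexMeasurability.
Local Open Scope complex_scope.
Context {d : measure_display} {T : measurableType d} {R : realType}.
Implicit Types (Z W : T -> R[i]).

Definition complex_measurable Z :=
  measurable_fun setT (fun w => complex.Re (Z w)) /\
  measurable_fun setT (fun w => complex.Im (Z w)).

Lemma complex_measurable_cst (z : R[i]) : complex_measurable (fun=> z).
Proof. by split; exact: measurable_cst. Qed.

Lemma complex_measurableM Z W : complex_measurable Z -> complex_measurable W ->
  complex_measurable (fun w => Z w * W w).
Proof.
move=> [Z1 Z2] [W1 W2]; split.
  rewrite (_ : (fun w => _) = (fun w => complex.Re (Z w) * complex.Re (W w) -
     complex.Im (Z w) * complex.Im (W w))).
    by apply: measurable_funB; apply: measurable_funM.
  by apply/funext => w; case: (Z w) => a b; case: (W w) => a' b'; simpc.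
rewrite (_ : (fun w => _) = (fun w => complex.Re (Z w) * complex.Im (W w) +
   complex.Im (Z w) * complex.Re (W w))).
  by apply: measurable_funD; apply: measurable_funM.
by apply/funext => w; case: (Z w) => a b; case: (W w) => a' b'; simpc.
Qed.

Lemma complex_measurableB Z W : complex_measurable Z -> complex_measurable W ->
  complex_measurable (fun w => Z w - W w).
Proof.
move=> [Z1 Z2] [W1 W2]; split.
  rewrite (_ : (fun w => _) = (fun w => complex.Re (Z w) - complex.Re (W w))).
    exact: measurable_funB.
  by apply/funext => w; case: (Z w) => a b; case: (W w) => a' b'; simpc.
rewrite (_ : (fun w => _) = (fun w => complex.Im (Z w) - complex.Im (W w))).
  exact: measurable_funB.
by apply/funext => w; case: (Z w) => a b; case: (W w) => a' b'; simpc.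
Qed.

Lemma complex_measurable_rot (X : T -> R) : measurable_fun setT X ->
  complex_measurable (fun w => cexp ((X w)%:C * 'i)).
Proof.
move=> mX; split.
  rewrite (_ : (fun w => _) = (fun w => cos (X w))).
    apply: (measurableT_comp _ mX).
    by apply: continuous_measurable_fun; exact: continuous_cos.
  by apply/funext => w; rewrite cexp_rotE.
rewrite (_ : (fun w => _) = (fun w => sin (X w))).
  apply: (measurableT_comp _ mX).
  by apply: continuous_measurable_fun; exact: continuous_sin.
by apply/funext => w; rewrite cexp_rotE.
Qed.

Lemma measurable_cabs Z : complex_measurable Z ->
  measurable_fun setT (fun w => cabs (Z w)).
Proof.
move=> [Z1 Z2].
rewrite (_ : (fun w => _) = (fun w =>
   Num.sqrt (complex.Re (Z w) ^+ 2 + complex.Im (Z w) ^+ 2))).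
  apply: (@measurableT_comp _ _ _ _ _ _ (@Num.sqrt R)).
    by apply: continuous_measurable_fun; exact: sqrt_continuous.
  by apply: measurable_funD; apply: measurable_funX.
by apply/funext => w; rewrite cabs_sqrt.
Qed.

Lemma measurable_lt_fun (X : T -> R) t : measurable_fun setT X ->
  measurable [set w | t < X w].
Proof.
move=> mX; rewrite (_ : [set w | _] = X @^-1` `]t, +oo[).
  by rewrite -[X in measurable X]setTI; exact: mX.
by apply/seteqP; split => w /=; rewrite in_itv/= andbT.
Qed.

Lemma measurable_gt_fun (X : T -> R) t : measurable_fun setT X ->
  measurable [set w | X w < t].
Proof.
move=> mX; rewrite (_ : [set w | _] = X @^-1` `]-oo, t[).
  by rewrite -[X in measurable X]setTI; exact: mX.
by apply/seteqP; split => w /=; rewrite in_itv.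
Qed.

Lemma measurable_fun_lt (X : T -> R) : (forall t, measurable [set w | t < X w]) ->
  measurable_fun setT X.
Proof.
move=> h mT; apply: (measurability _ (RGenOInfty.measurableE R)) => //.
move=> /= _ [_ [x ->] <-]; rewrite setTI.
rewrite (_ : _ @^-1` _ = [set w | x < X w])//.
by apply/seteqP; split => w /=; rewrite in_itv/= andbT.
Qed.

(** The set where h o Z exceeds t is a countable union of preimages of small rational
discs, those in which h exceeds t at every point of the exterior disc. *)
Lemma measurable_outside_comp (h : R[i] -> R) Z : complex_measurable Z ->
  (forall w, 1 < cabs (Z w)) ->
  (forall z, 1 < cabs z -> forall e : R, 0 < e ->
    exists2 dl : R, 0 < dl & forall z', 1 < cabs z' -> cabs (z' - z) < dl ->
    `|h z' - h z| < e) ->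
  measurable_fun setT (fun w => h (Z w)).
Proof.
move=> mZ Z1 ch; apply: measurable_fun_lt => t.
pose ctr (i : rat * rat * nat) : R[i] := ratr i.1.1 +i* ratr i.1.2.
pose good (i : rat * rat * nat) := forall z, 1 < cabs z ->
  cabs (z - ctr i) < i.2.+1%:R^-1 -> t < h z.
pose F (i : rat * rat * nat) : set T :=
  [set w | good i /\ cabs (Z w - ctr i) < i.2.+1%:R^-1].
rewrite (_ : [set w | _] = \bigcup_i F i).
  apply: countable_bigcupT_measurable => [|i]; first exact: countableP.
  have [gi|ngi] := pselect (good i); last first.
    by rewrite (_ : F i = set0)//; apply/seteqP; split => w // -[].
  rewrite (_ : F i = [set w | cabs (Z w - ctr i) < i.2.+1%:R^-1]).
    apply: measurable_gt_fun; apply: measurable_cabs.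
    exact: (complex_measurableB mZ (complex_measurable_cst (ctr i))).
  by apply/seteqP; split => w // -[].
apply/seteqP; split => [w /= tw|w [i _ [gi wi]]] /=; last exact: gi.
have e0 : 0 < h (Z w) - t by rewrite subr_gt0.
have [dl dl0 hdl] := ch _ (Z1 w) _ e0.
have [k hk] : exists k : nat, k.+1%:R^-1 < dl / 2.
  have [k _ /(_ k (leqnn _)) hk] := near_infty_natSinv_lt (PosNum (divr_gt0 dl0 (ltr0Sn R 1))).
  by exists k.
have k0 : 0 < k.+1%:R^-1 :> R by rewrite invr_gt0.
have [pq hpq] := rational_approx (Z w) k0.
exists (pq, k) => //; split => //= z z1 hz.
have : cabs (z - Z w) < dl.
  have -> : z - Z w = (z - ctr (pq, k)) - (Z w - ctr (pq, k)) by ring.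
  rewrite (le_lt_trans (cabsD _ _))// cabsN [ltRHS](splitr dl) ltrD//.
    exact: lt_trans hz hk.
  exact: lt_trans hpq hk.
move=> /(hdl _ z1); rewrite ltr_norml => /andP[+ _]; lra.
Qed.

Lemma complex_measurable_comp (g : R[i] -> R[i]) Z : complex_measurable Z ->
  (forall w, 1 < cabs (Z w)) -> continuous_outside g ->
  complex_measurable (fun w => g (Z w)).
Proof.
move=> mZ Z1 cg; split.
  apply: (@measurable_outside_comp (fun z => complex.Re (g z))) => // z z1 e e0.
  have [dl dl0 hdl] := cg _ z1 _ e0; exists dl => // z' z'1 /(hdl _ z'1).
  by apply: le_lt_trans; rewrite -ReB Re_le_cabs.
apply: (@measurable_outside_comp (fun z => complex.Im (g z))) => // z z1 e e0.
have [dl dl0 hdl] := cg _ z1 _ e0; exists dl => // z' z'1 /(hdl _ z'1).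
by apply: le_lt_trans; rewrite -ImB Im_le_cabs.
Qed.

End ComplexMeasurability.

Section DeviationMeasurability.
Local Open Scope complex_scope.
Context {d : measure_display} {T : measurableType d} {R : realType}.
Variables (P : probability T R) (alpha c : R) (f : R -> R[i] -> R[i]).
Hypothesis (alpha_gt0 : 0 < alpha) (c_gt0 : 0 < c) (hf : particle_maps c f).

Let capP i : 0 < capacity alpha c i <= c.
Proof. by rewrite capacity_gt0// capacity_le. Qed.

Let cf i : continuous_outside (f (capacity alpha c i)).
Proof. by have [Q [_ _ [h _ _]]] := hf (capP i); exact: derivable_continuous_outside. Qed.

Let pf i : preserves_outside (f (capacity alpha c i)).
Proof.
have [Q [_ _ [_ _ h]]] := hf (capP i); move=> z z1.
have : (f (capacity alpha c i) @` (@exterior_disc R)) (f (capacity alpha c i) z).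
  by exists z.
by rewrite h => -[].
Qed.

Lemma continuous_outside_cluster_map theta n :
  continuous_outside (cluster_map alpha c f theta n).
Proof.
elim: n => [|n IH] /=; first by move=> z z1 e e0; exists e.
apply: continuous_outside_comp => //; first exact: continuous_outside_rotated.
exact: preserves_outside_rotated.
Qed.

Lemma complex_measurable_orbit (theta : nat -> {RV P >-> R}) n (z : R[i]) j :
  1 < cabs z -> (j <= n)%N ->
  complex_measurable (fun w => inner_orbit alpha c f (fun i => theta i w) n z (n - j)) /\
  forall w, 1 < cabs (inner_orbit alpha c f (fun i => theta i w) n z (n - j)).
Proof.
move=> z1; elim: j => [_|j IH jn].
  rewrite subn0; split; last by move=> w; rewrite inner_orbit_nn.
  under eq_fun do rewrite inner_orbit_nn.
  exact: complex_measurable_cst.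
have [] := IH (ltnW jn).
have -> : (n - j = (n - j.+1).+1)%N by rewrite subnS prednK// subn_gt0.
move: (n - j.+1)%N (leq_subr j n) => k _ IH1 IH2.
have [kn|nk] := ltnP k n; last first.
  have e th : inner_orbit alpha c f th n z k = z.
    by rewrite /inner_orbit /index_iota (eqP nk).
  split; last by move=> w; rewrite e.
  by under eq_fun do rewrite e; exact: complex_measurable_cst.
split; last first.
  by move=> w; rewrite inner_orbitS//; exact: preserves_outside_rotated.
under eq_fun do rewrite inner_orbitS//.
have mt : measurable_fun setT (theta k) by [].
apply: complex_measurableM; first exact: complex_measurable_rot.
apply: (complex_measurable_comp _ _ (@cf k)).
  apply: complex_measurableM => //.
  under eq_fun do rewrite -rmorphN/=.
  apply: complex_measurable_rot; exact: measurable_funN.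
by move=> w; rewrite cabsM cabs_rotN mulr1.
Qed.

(** By continuity of the cluster map, the supremum over |z| >= r exceeds t as soon as
the deviation does so at a rational point of the same region. *)
Lemma measurable_large_deviation (r : R) (theta : nat -> {RV P >-> R}) n : 1 < r ->
  measurable (large_deviation alpha c r f theta n).
Proof.
move=> r1.
pose t : R := ln n%:R / Num.sqrt n%:R.
pose E : R[i] := (expR (- \sum_(i < n) capacity alpha c i))%:C.
pose D w z := cabs (E * cluster_map alpha c f (fun i => theta i w) n z - z).
pose ctr (i : rat * rat) : R[i] := ratr i.1 +i* ratr i.2.
pose F (i : rat * rat) : set T := [set w | r <= cabs (ctr i) /\ t < D w (ctr i)].
have -> : large_deviation alpha c r f theta n = \bigcup_i F i.
  apply/seteqP; split => [w|w [i _ [ri ti]]]; last first.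
    have h1 : (t%:E < (D w (ctr i))%:E)%E by rewrite lte_fin.
    by apply: (lt_le_trans h1); apply: ereal_sup_ubound; exists (ctr i).
  move=> /ereal_sup_gt[_ [z /= rz <-]]; rewrite lte_fin -/t => tz.
  have z1 : 1 < cabs z by rewrite (lt_le_trans r1).
  have z0 : 0 < cabs z by rewrite (lt_trans ltr01).
  have E0 : 0 < cabs E by rewrite cabs_real gtr0_norm expR_gt0.
  have [dl dl0 hdl] : exists2 dl : R, 0 < dl & forall z', 1 < cabs z' ->
      cabs (z' - z) < dl -> t < D w z'.
    pose e := (D w z - t) / 2.
    have e0 : 0 < e by rewrite divr_gt0// subr_gt0.
    have eE0 : 0 < e / cabs E by rewrite divr_gt0.
    have [d1 d10 h1] := @continuous_outside_cluster_map (fun i => theta i w) n z z1 _ eE0.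
    exists (Num.min d1 e); first by rewrite lt_min d10.
    move=> z' z'1; rewrite lt_min => /andP[/(h1 _ z'1) h2 h3].
    have h4 : D w z - D w z' <= cabs E * cabs (cluster_map alpha c f (fun i => theta i w) n z' -
       cluster_map alpha c f (fun i => theta i w) n z) + cabs (z' - z).
      rewrite (le_trans (cabsB_ge _ _))// -cabsM -(cabsN (E * _)).
      apply: le_trans (cabsD _ _); rewrite le_eqVlt; apply/orP; left; apply/eqP.
      by congr cabs; ring.
    rewrite ltr_pdivlMr// mulrC in h2.
    have eE : e + e = D w z - t by rewrite -splitr.
    lra.
  (* push z slightly outwards, so that a rational approximation has modulus >= r
     even when |z| = r *)
  pose z' := (1 + dl / 2 / cabs z)%:C * z.
  have cz' : cabs z' = cabs z + dl / 2.
    rewrite cabsM cabs_real ger0_norm; last by rewrite addr_ge0// !divr_ge0 ?ltW.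
    by rewrite mulrDl mul1r divfK// gt_eqF.
  have dz' : cabs (z' - z) = dl / 2.
    have -> : z' - z = (dl / 2 / cabs z)%:C * z by rewrite /z' rmorphD/=; ring.
    rewrite cabsM cabs_real ger0_norm; last by rewrite !divr_ge0 ?ltW.
    by rewrite divfK// gt_eqF.
  have dl20 : 0 < dl / 2 by rewrite divr_gt0.
  have [pq hpq] := rational_approx z' dl20.
  have rpq : r <= cabs (ctr pq).
    have h5 : z' - (z' - ctr pq) = ctr pq by ring.
    have := cabsB_ge z' (z' - ctr pq); rewrite h5.
    have : cabs (z' - ctr pq) < dl / 2 by exact: hpq.
    lra.
  exists pq => //; split => //; apply: hdl; first by rewrite (lt_le_trans r1).
  have -> : ctr pq - z = (z' - z) - (z' - ctr pq) by ring.
  rewrite (le_lt_trans (cabsD _ _))// cabsN dz' [ltRHS](splitr dl) ltrD2l.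
  exact: hpq.
apply: countable_bigcupT_measurable => [|i]; first exact: countableP.
have [ri|nri] := boolP (r <= cabs (ctr i)); last first.
  by rewrite (_ : F i = set0)//; apply/seteqP; split => w // -[]; rewrite (negbTE nri).
rewrite (_ : F i = [set w | t < D w (ctr i)]); last by apply/seteqP; split => w // -[].
apply: measurable_lt_fun; apply: measurable_cabs.
apply: complex_measurableB; last exact: complex_measurable_cst.
apply: complex_measurableM; first exact: complex_measurable_cst.
under eq_fun do rewrite cluster_map_orbit.
have ci1 : 1 < cabs (ctr i) by rewrite (lt_le_trans r1).
have [+ _] := complex_measurable_orbit theta ci1 (leqnn n).
by rewrite subnn.
Qed.

End DeviationMeasurability.

(** * The deviation bound *)

Section Asymptotics.
Context {R : realType}.

(** With y = n^(1/4), ln n = 4 ln y < 4 y, so that ln n / sqrt n < 4 / y. *)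
Lemma ln_over_sqrt_small (B rho : R) : 0 < rho -> exists2 n0 : nat, (0 < n0)%N &
  forall n, (n0 <= n)%N -> B <= ln n%:R /\ ln n%:R / Num.sqrt n%:R <= rho :> R.
Proof.
move=> rho0.
have [n1 hn1] : exists n : nat, expR B <= n%:R :> R.
  by exists (Num.bound (expR B)); rewrite ltW// archi_boundP// expR_ge0.
have [n2 hn2] : exists n : nat, (4 / rho) ^+ 4 <= n%:R :> R.
  exists (Num.bound ((4 / rho) ^+ 4)); rewrite ltW// archi_boundP//.
  by rewrite exprn_ge0// divr_ge0// ltW.
exists (maxn 1 (maxn n1 n2)) => [|n]; first by rewrite leq_max.
rewrite !geq_max => /and3P[n0 nn1 nn2].
have N0 : 0 < n%:R :> R by rewrite ltr0n.
split.
  rewrite -ler_expR lnK ?posrE//; apply: (le_trans hn1).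
  by rewrite ler_nat.
have [y yE] : {y | y = Num.sqrt (Num.sqrt n%:R) :> R} by eexists.
have y0 : 0 < y by rewrite yE !sqrtr_gt0.
have y2 : Num.sqrt n%:R = y ^+ 2 by rewrite yE sqr_sqrtr// sqrtr_ge0.
have y4 : n%:R = y ^+ 4 :> R.
  by rewrite (exprM y 2 2) -y2 sqr_sqrtr// ltW.
have hy : 4 / rho <= y.
  have h : (4 / rho) ^+ 4 <= y ^+ 4 by rewrite -y4 (le_trans hn2)// ler_nat.
  rewrite -(ler_pXn2r (n := 4))// nnegrE ?(ltW y0)//.
  by rewrite divr_ge0// ltW.
rewrite y2 y4 lnXn// ler_pdivrMr ?exprn_gt0//.
have h1 := ltW (ln_sublinear y0).
have h2 : 4 <= rho * y by rewrite mulrC -ler_pdivrMr.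
rewrite -mulr_natl expr2 mulrA.
apply: (@le_trans _ _ (4 * y)); first by rewrite ler_wpM2l.
by rewrite ler_wpM2r// ltW.
Qed.

Lemma twice_le_sqr_div (x k : R) : 0 < k -> 2 * x <= x ^+ 2 / k + k.
Proof.
move=> k0.
have h : 0 <= (x - k) ^+ 2 / k by rewrite divr_ge0 ?sqr_ge0// ltW.
have : (x - k) ^+ 2 / k = x ^+ 2 / k - 2 * x + k by field; rewrite gt_eqF.
lra.
Qed.

(** Comparison with the telescoping series of 2 / ((n+1) (n+2)). *)
Lemma inv_sqr_summable d (T : measurableType d) (P : probability T R)
    (A : nat -> set T) (K : R) :
  (forall n, (P (A n) <= (K / n.+1%:R ^+ 2)%:E)%E) -> 0 <= K ->
  (\sum_(n <oo) P (A n) < +oo)%E.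
Proof.
move=> hA K0.
apply: (@le_lt_trans _ _ (2 * K)%:E); last exact: ltry.
apply: lime_le; first exact: is_cvg_nneseries.
apply: nearW => N.
apply: (@le_trans _ _ (\sum_(0 <= n < N) (K / n.+1%:R ^+ 2)%:E)%E).
  by apply: lee_sum => i _; exact: hA.
rewrite sumEFin lee_fin.
apply: (@le_trans _ _ (\sum_(0 <= n < N) 2 * K * (- n.+2%:R^-1 - (- n.+1%:R^-1)))).
  apply: ler_sum => n _.
  have m0 : 0 < n.+1%:R :> R by rewrite ltr0n.
  have -> : n.+2%:R = n.+1%:R + 1 :> R by rewrite natr1.
  have m1 : 1 <= n.+1%:R :> R by rewrite ler1n.
  move: (n.+1%:R) m0 m1 => m m0 m1.
  have -> : 2 * K * (- (m + 1)^-1 - - m^-1) = K * (2 / (m * (m + 1))).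
    by field; apply/andP; split; rewrite gt_eqF// addr_gt0.
  rewrite ler_wpM2l//.
  have -> : 2 / (m * (m + 1)) = (m * (m + 1) / 2)^-1.
    by field; apply/andP; split; rewrite gt_eqF// addr_gt0.
  rewrite lef_pV2 ?posrE ?exprn_gt0 ?divr_gt0 ?mulr_gt0 ?addr_gt0//.
  nra.
rewrite -mulr_sumr (telescope_sumr (fun n => - n.+1%:R^-1))//.
by rewrite invr1 opprK ler_piMr ?mulr_ge0// gerDr oppr_le0 invr_ge0 ler0n.
Qed.

End Asymptotics.

Theorem theorem1p2 (R : realType) (alpha c lambda r : R)
    (alpha_bounds : 0 < alpha < 2) (c_gt0 : 0 < c) (lambda_ge0 : 0 <= lambda)
    (r_gt1 : 1 < r) :
  exists lambda1 lambda2 : R, [/\ 0 < lambda1, 0 < lambda2 &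
    forall f delta : R -> R[i] -> R[i],
      particle_maps c f -> particle_estimate c lambda f delta ->
    forall (d : measure_display) (T : measurableType d) (P : probability T R)
           (theta : nat -> {RV P >-> R}),
      mutually_independent theta -> (forall n, uniform_angle (theta n)) ->
      (forall n : nat, (1 <= n)%N ->
         (P (large_deviation alpha c r f theta n)
            < (lambda1 * expR (- (ln n%:R ^+ 2 / lambda2)))%:E)%E) /\
      P (lim_sup_set (large_deviation alpha c r f theta)) = 0%E].
Proof.
have /andP[alpha_gt0 alpha_lt2] := alpha_bounds.
have [K1 K10 hdev] := normalized_deviation_le alpha_gt0 alpha_lt2 c_gt0 lambda_ge0 r_gt1.
have [K2 K20 hfluct] := sum_fluctuation_le alpha_gt0 c_gt0 r_gt1.
have [K3 K30 hsqr] := sum_sqr_capacity_tail_le alpha_gt0 alpha_lt2 c_gt0.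
(* thresholds t = e L / s with L = ln n and s = sqrt n: this e makes their
   contribution 2 K1 K2 t to the deviation equal to half of L / s *)
have [e eE] : {e | e = (4 * (K1 * K2))^-1} by eexists.
have e0 : 0 < e by rewrite eE invr_gt0 !mulr_gt0.
(* the exponent t^2 / (64 V) of the tail bound is L^2 / k when V = K3 / n *)
have [k kE] : {k | k = 64 * K3 / e ^+ 2} by eexists.
have k0 : 0 < k by rewrite kE divr_gt0 ?exprn_gt0 ?mulr_gt0.
have r10 : 0 < (r - 1) / 2 by rewrite divr_gt0 ?subr_gt0.
have [n0 n00 hn0] := ln_over_sqrt_small (2 * (K1 * (K2 + 1))) r10.
(* the middle term takes care of the indices below n0 *)
have [l1 l1E] : {l1 | l1 = 4 * expR (2 * k) + expR (ln n0%:R ^+ 2 / (2 * k)) + 1} by eexists.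
have l10 : 0 < l1 by rewrite l1E !addr_gt0// ?mulr_gt0// expR_gt0.
have l20 : 0 < 2 * k by rewrite mulr_gt0.
exists l1, (2 * k); split => // f delta hf hest d T P theta hind hunif.
have mLD n := measurable_large_deviation alpha_gt0 c_gt0 hf theta n r_gt1.
have P1 n : (P (large_deviation alpha c r f theta n) <= 1)%E by exact: probability_le1.
have tail n : (1 <= n)%N -> (P (large_deviation alpha c r f theta n)
            < (l1 * expR (- (ln n%:R ^+ 2 / (2 * k))))%:E)%E.
  move=> n1; have [nn0|n0n] := ltnP n n0.
    apply: (le_lt_trans (P1 n)); rewrite lte_fin l1E.
    have ln0 : 0 <= ln n%:R :> R by rewrite ln_ge0// ler1n.
    have hl : ln n%:R <= ln n0%:R :> R.
      by rewrite ler_ln ?posrE ?ltr0n// ler_nat ltnW.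
    have h1 : expR (- (ln n0%:R ^+ 2 / (2 * k))) <= expR (- (ln n%:R ^+ 2 / (2 * k))).
      rewrite ler_expR lerN2 ler_wpM2r ?invr_ge0 ?(ltW l20)//.
      by rewrite lerXn2r ?nnegrE// (le_trans ln0).
    have h2 : expR (ln n0%:R ^+ 2 / (2 * k)) * expR (- (ln n0%:R ^+ 2 / (2 * k))) = 1.
      by rewrite -expRD subrr expR0.
    have h3 : 0 < expR (ln n0%:R ^+ 2 / (2 * k)) := expR_gt0 _.
    have h4 : 0 < expR (- (ln n%:R ^+ 2 / (2 * k))) := expR_gt0 _.
    have h5 : 0 < expR (2 * k) := expR_gt0 _.
    nra.
  have [hL1 hL2] := hn0 _ n0n.
  have nR : 0 < n%:R :> R by rewrite ltr0n.
  have ln0 : 0 <= ln n%:R :> R by rewrite ln_ge0// ler1n.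
  have [s sE] : {s : R | s = Num.sqrt n%:R} by eexists.
  have s0 : 0 < s by rewrite sE sqrtr_gt0.
  have s2 : s ^+ 2 = n%:R by rewrite sE sqr_sqrtr// ltW.
  have [L LE] : {L : R | L = ln n%:R} by eexists.
  rewrite -LE -sE in hL1 hL2; rewrite -LE in ln0.
  pose t := e * L / s.
  have t0 : 0 <= t by rewrite /t divr_ge0 ?mulr_ge0 ?(ltW e0)// ltW.
  have V0 : 0 < K3 / n%:R by rewrite divr_gt0.
  have [mB PB] := bad_event_tail alpha_gt0 c_gt0 hind hunif V0 t0 (hsqr n n1).
  have KL : K1 * (K2 * (2 * t + s^-1) + s^-1) <= L / s.
    have -> : K1 * (K2 * (2 * t + s^-1) + s^-1) = (L / 2 + K1 * (K2 + 1)) / s.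
      by rewrite /t eE; field; rewrite !gt_eqF.
    by rewrite ler_pM2r ?invr_gt0//; lra.
  have sub : large_deviation alpha c r f theta n `<=` bad_event alpha c theta n t.
    move=> w hw; apply: contrapT => hbad.
    have hB := not_bad_event t0 hbad.
    move: hw; rewrite /large_deviation /= ltNge => /negP; apply.
    apply: ub_ereal_sup => _ [z /= rz <-]; rewrite lee_fin.
    have hfl j : (j <= n)%N -> cabs (\sum_(j <= i < n)
        fluctuation alpha c (fun i => theta i w) n z i) <= K2 * (2 * t + s^-1).
      by move=> _; rewrite sE; apply: hfluct => // m; exact: hB.
    have := hdev f delta hest (fun i => theta i w) n _ z n1 rz hfl.
    rewrite -sE -LE => /(_ (le_trans KL hL2)).
    rewrite {1}/tail_capacity big_mkord => h.
    exact: le_trans h KL.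
  apply: (@le_lt_trans _ _ (P (bad_event alpha c theta n t))).
    by apply: le_measure => //; rewrite inE.
  apply: (le_lt_trans PB); rewrite lte_fin -LE.
  have -> : t ^+ 2 / (64 * (K3 / n%:R)) = L ^+ 2 / k.
    by rewrite /t kE -s2; field; rewrite !gt_eqF.
  have -> : n%:R * (n%:R * (4 * expR (- (L ^+ 2 / k)))) = 4 * expR (2 * L - L ^+ 2 / k).
    rewrite expRD expRM_natl LE lnK ?posrE// -LE; ring.
  (* half of the Gaussian exponent absorbs the 4 n^2 events *)
  apply: (@le_lt_trans _ _ (4 * expR (2 * k) * expR (- (L ^+ 2 / (2 * k))))).
    rewrite -mulrA -expRD ler_wpM2l// ler_expR.
    have -> : L ^+ 2 / k = L ^+ 2 / (2 * k) + L ^+ 2 / (2 * k).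
      by field; rewrite gt_eqF.
    have := twice_le_sqr_div L l20; lra.
  rewrite ltr_pM2r ?expR_gt0// l1E -addrA ltrDl addr_gt0// expR_gt0//.
split => //.
apply: lim_sup_set_cvg0 => //.
apply: (@inv_sqr_summable _ _ _ P _ (4 * (l1 * expR (2 * k)) + 1)); last first.
  by rewrite addr_ge0// !mulr_ge0 ?expR_ge0 ?(ltW l10).
case=> [|n].
  rewrite (le_trans (P1 _))// lee_fin expr1n divr1 lerDr.
  by rewrite !mulr_ge0 ?expR_ge0 ?(ltW l10).
apply: (le_trans (ltW (tail n.+1 (ltn0Sn n)))); rewrite lee_fin.
have nR : 0 < n.+1%:R :> R by rewrite ltr0n.
have n1R : 1 <= n.+1%:R :> R by rewrite ler1n.
have h1 : expR (- (ln n.+1%:R ^+ 2 / (2 * k))) <= expR (2 * k) / n.+1%:R ^+ 2.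
  have -> : expR (2 * k) / n.+1%:R ^+ 2 = expR (2 * k - 2 * ln n.+1%:R).
    by rewrite expRD expRN (expRM_natl 2 (ln n.+1%:R)) lnK ?posrE.
  rewrite ler_expR; have := twice_le_sqr_div (ln n.+1%:R) l20; lra.
have -> : n.+2%:R = n.+1%:R + 1 :> R by rewrite natr1.
apply: (@le_trans _ _ (l1 * (expR (2 * k) / n.+1%:R ^+ 2))).
  by rewrite ler_wpM2l// ltW.
have h5 : 0 < expR (2 * k) := expR_gt0 _.
have h6 : 0 < l1 * expR (2 * k) by rewrite mulr_gt0.
rewrite mulrA ler_pdivlMr ?exprn_gt0 ?addr_gt0// mulrAC ler_pdivrMr ?exprn_gt0//.
move: (n.+1%:R) (l1 * expR (2 * k)) nR n1R h6 => m q nR n1R h6.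
have h7 : (m + 1) ^+ 2 <= 4 * m ^+ 2 by nra.
have h8 : 0 <= m ^+ 2 by rewrite sqr_ge0.
nra.
Qed.
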